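(* Fix $k\in\mathbb N$ and $t\in\mathbb N_0$. Consider pairs $(Z^{(1:k)}[t],A^{(1:k,1:k)}[t])$ satisfying the common requirements listed in the context, and the conditional-structure conditions (a), (b), (c) listed there. Then each of (a), (b) and (c) individually (together with the common requirements) characterizes the joint distribution of $(Z^{(1:k)}[t],A^{(1:k,1:k)}[t])$, and the distributions described by (a), (b) and (c) are the same.
   Context: **Notation.** $[t]=\{0,\dots,t\}$, $[1:k]=\{1,\dots,k\}$, $\mathcal I_k=\{(i,j):1\le i<j\le k\}$; $\mathcal M_t(\mathcal X)$ is the space of functions $[t]\to\mathcal X$; for a trajectory $x$, $x[s]=(x(0),\dots,x(s))$. **Data.** $d\in\mathbb N$, $\gamma\in(0,1)$; a.e. continuous functions $B:\{0,1\}\times\mathbb R^d\times\mathbb R^d\to[0,1]$ and $B_0:\mathbb R^d\times\mathbb R^d\to[0,1]$, symmetric in the two $\mathbb R^d$-arguments; an absolutely continuous probability measure $\mu_0$ on $\mathbb R^d$; an absolutely continuous noise law on $\mathbb R^d$. Let $\widehat B(p,x,y)=pB(1,x,y)+(1-p)B(0,x,y)$ and, for trajectories $z_1,z_2$, recursively $B_s(z_1[s],z_2[s])=\widehat B\big(B_{s-1}(z_1[s-1],z_2[s-1]),z_1(s),z_2(s)\big)$ for $s>0$, starting from $B_0(z_1(0),z_2(0))$. **$\sigma$-algebras.** $\mathcal F^k_s=\sigma(Z^{(1:k)}[s],A^{(1:k,1:k)}[s])$, $\mathcal G^k_s=\sigma(Z^{(1:k)}[s])$, $\mathcal G^{A,k}_s=\sigma(Z^{(1:k)}[s],A^{(1:k,1:k)}[s-1])$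 for $s>0$ and $\mathcal G^{A,k}_0=\sigma(Z^{(1:k)}(0))$. **Common requirements.** $Z^{(i)}(0)$, $i\in[1:k]$, are i.i.d. with law $\mu_0$. For each $i$, $Z^{(i)}$ solves $$Z^{(i)}(s+1)=(1-\gamma)Z^{(i)}(s)+\gamma L^{(i)}(s)+\xi_i(s),\qquad L^{(i)}(s)=\frac{\int z(s)\,B_s(Z^{(i)}[s],z)\,\mu_s(dz)}{\int B_s(Z^{(i)}[s],z)\,\mu_s(dz)},$$ where $\mu_s=\mathrm{Law}(Z^{(1)}[s])$ (it being part of the requirement that the quotient is a.s. well defined), $\{\xi_i(s)\}$ are i.i.d. with the noise law, and for each $s$, $\xi_{1:k}(s)$ is independent of $\mathcal F^k_s$. For $i\ne j$, $A^{(ij)}(s)$ is $\{0,1\}$-valued with $$\mathbb E[A^{(ij)}(s)\mid\mathcal G^{A,k}_s]=\begin{cases} B(A^{(ij)}(s-1),Z^{(i)}(s),Z^{(j)}(s)),&s>0,\\ B_0(Z^{(i)}(0),Z^{(j)}(0)),&s=0,\end{cases}$$ $A^{(ij)}[t]=A^{(ji)}[t]$, and $A^{(ii)}(s)=1$ for all $s\in[t]$. **Conditional structures.** (a) For each $s\in[t]$, the variables $\{A^{(ij)}(s)\}_{(i,j)\in\mathcal I_k}$ are mutually conditionally independent given $\mathcal G^{A,k}_s$. (b) The $\mathcal M_t(\{0,1\})$-random elements $\{A^{(ij)}[t]\}_{(i,j)\in\mathcal I_k}$ are mutually conditionally independent given $\mathcal G^k_t$; and for $(i,j)\in\mathcal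 I_k$, $A^{(ij)}[t]$ is a conditional Markov chain given $\mathcal G^k_t$ with $\mathbb P(A^{(ij)}(0)=1\mid\mathcal G^k_t)=B_0(Z^{(i)}(0),Z^{(j)}(0))$ and $\mathbb P(A^{(ij)}(s)=1\mid\mathcal G^k_t,A^{(ij)}(s-1)=a)=B(a,Z^{(i)}(s),Z^{(j)}(s))$ for $s>0$, $a\in\{0,1\}$. (c) For every $s\in[t]$, the $\mathcal M_s(\{0,1\})$-random elements $\{A^{(ij)}[s]\}_{(i,j)\in\mathcal I_k}$ are mutually conditionally independent given $\mathcal G^k_s$. *)

(* Defs.v *)
From HB Require Import structures.
From mathcomp Require Import all_boot all_order all_algebra.
From mathcomp Require Import all_classical all_reals all_analysis.

Set Implicit Arguments.
Unset Strict Implicit.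
Unset Printing Implicit Defensive.

Import Order.TTheory GRing.Theory Num.Theory.
Import numFieldNormedType.Exports.

Local Open Scope classical_set_scope.
Local Open Scope ring_scope.

Section measurable_rV.
Context {disp : measure_display} {T : measurableType disp} (n : nat).

Let coord (j : 'I_n) (x : 'rV[T]_n) : T := x ord0 j.

Let rV_set0 : g_sigma_preimage coord set0.
Proof. exact: sigma_algebra0. Qed.

Let rV_setC E : g_sigma_preimage coord E -> g_sigma_preimage coord (~` E).
Proof. exact: sigma_algebraC. Qed.

Let rV_bigcup (F : (set 'rV[T]_n)^nat) :
  (forall i, g_sigma_preimage coord (F i)) ->
  g_sigma_preimage coord (\bigcup_i F i).
Proof. exact: sigma_algebra_bigcup. Qed.

HB.instance Definition _ := @isMeasurable.Build (measure_tuple_display disp)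
  'rV[T]_n (g_sigma_preimage coord) rV_set0 rV_setC rV_bigcup.

End measurable_rV.

Lemma measurable_fun_rVP d1 d2 (T1 : measurableType d1) (T2 : measurableType d2)
    (n : nat) (f : T1 -> 'rV[T2]_n) :
  (forall j, measurable_fun [set: T1] (fun x => f x ord0 j)) ->
  measurable_fun [set: T1] f.
Proof.
move=> mf.
have fS : g_sigma_preimage (fun j x => f x ord0 j) `<=` measurable.
  apply: smallest_sub; first exact: sigma_algebra_measurable.
  elim/big_ind: _ => // [|j _ _ [E mE <-]]; last exact: mf.
  by move=> ? ? ? ?; rewrite subUset; split.
move=> _ E mE; apply: fS.
rewrite (g_sigma_preimage_comp (fun j (x : 'rV[T2]_n) => x ord0 j) f).
by exists E.
Qed.

Lemma measurable_rV_coord d (T : measurableType d) (n : nat) (j : 'I_n) :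
  measurable_fun [set: 'rV[T]_n] (fun x => x ord0 j).
Proof.
move=> _ E mE; rewrite setTI; apply: sub_sigma_algebra => /=.
by rewrite -bigcup_seq/=; exists j; [rewrite /= mem_index_enum|exists E; rewrite ?setTI].
Qed.

Section lebesgue_rV.
Variable R : realType.
Implicit Type n : nat.

Definition cons_rV n (p : measurableTypeR R * 'rV[R]_n) : 'rV[R]_n.+1 :=
  \row_j if unlift ord0 j is Some i then p.2 ord0 i else p.1.

Definition uncons_rV n (x : 'rV[R]_n.+1) : measurableTypeR R * 'rV[R]_n :=
  (x ord0 ord0, \row_i x ord0 (lift ord0 i)).

Let measurable_cons_rV n : measurable_fun setT (@cons_rV n).
Proof.
apply: measurable_fun_rVP => j.
under eq_fun do rewrite mxE.
case: (unlift ord0 j) => [i|]; last exact: measurable_fst.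
exact: (measurableT_comp (measurable_rV_coord i) measurable_snd).
Qed.

Let measurable_uncons_rV n : measurable_fun setT (@uncons_rV n).
Proof.
apply/measurable_fun_pairP; split; first exact: measurable_rV_coord.
apply: measurable_fun_rVP => j.
under eq_fun do rewrite mxE.
exact: measurable_rV_coord.
Qed.

Let uncons_rVK n : cancel (@uncons_rV n) (@cons_rV n).
Proof.
move=> x; apply/rowP => j; rewrite mxE.
by case: unliftP => [i ->|->] //=; rewrite mxE.
Qed.

Let cons_rVK n : cancel (@cons_rV n) (@uncons_rV n).
Proof.
move=> [a x]; congr pair; first by rewrite /= mxE unlift_none.
by apply/rowP => j; rewrite !mxE liftK.
Qed.

Section cons_measure.
Variables (n : nat).
Variable m : {sigma_finite_measure set 'rV[R]_n -> \bar R}.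

Definition cons_measure : set 'rV[R]_n.+1 -> \bar R :=
  pushforward (@lebesgue_measure R \x m)%E (@cons_rV n).

Let pre (E : set 'rV[R]_n.+1) : measurable E -> measurable (@cons_rV n @^-1` E).
Proof. by move=> mE; rewrite -[X in measurable X]setTI; exact: measurable_cons_rV. Qed.

Let cons_measure0 : cons_measure set0 = 0%E.
Proof. by rewrite /cons_measure /pushforward preimage_set0 measure0. Qed.

Let cons_measure_ge0 E : (0 <= cons_measure E)%E.
Proof. exact: (measure_ge0 (lebesgue_measure \x m)%E). Qed.

Let cons_measure_sigma_additive : semi_sigma_additive cons_measure.
Proof.
move=> F mF tF mUF; rewrite /cons_measure /pushforward preimage_bigcup.
apply: measure_semi_sigma_additive.
- by move=> i; exact: pre.
- apply/trivIsetP => /= i j _ _ ij; rewrite -preimage_setI.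
  by move/trivIsetP : tF => /(_ _ _ _ _ ij) ->//; rewrite preimage_set0.
- by rewrite -preimage_bigcup; exact: pre.
Qed.

HB.instance Definition _ := isMeasure.Build _ _ _ cons_measure
  cons_measure0 cons_measure_ge0 cons_measure_sigma_additive.

Let cons_measure_sigma_finite : sigma_finite setT cons_measure.
Proof.
have /sigma_finiteP[F [FT ndF Foo]] := sigma_finiteT (@lebesgue_measure R).
have /sigma_finiteP[G [GT ndG Goo]] := sigma_finiteT m.
exists (fun i => @uncons_rV n @^-1` (F i `*` G i)).
  rewrite -preimage_bigcup -[LHS](preimage_setT (@uncons_rV n)).
  congr (_ @^-1` _); rewrite -setXTT FT GT; apply/seteqP; split.
    move=> [x y] [/= [i _ Fx] [j _ Gy]]; exists (maxn i j) => //; split => /=.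
    - by move: x Fx; exact/subsetPset/ndF/leq_maxl.
    - by move: y Gy; exact/subsetPset/ndG/leq_maxr.
  by move=> [x y] [i _ [/= Fx Gy]]; split; exists i.
move=> i; have [mF Fi] := Foo i; have [mG Gi] := Goo i; split.
  by rewrite -[X in measurable X]setTI; apply: measurable_uncons_rV => //;
    exact: measurableX.
rewrite /cons_measure /pushforward -comp_preimage.
rewrite (_ : _ \o _ = id); last by apply/funext => p; exact: cons_rVK.
by rewrite product_measure1E// lte_mul_pinfty// ge0_fin_numE.
Qed.

HB.instance Definition _ := Measure_isSigmaFinite.Build _ _ _ cons_measure
  cons_measure_sigma_finite.
End cons_measure.

Fixpoint lebesgue_rV n : {sigma_finite_measure set 'rV[R]_n -> \bar R} :=
  match n with
  | 0 => \d_(0 : 'rV[R]_0)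
  | n'.+1 => cons_measure (lebesgue_rV n')
  end.
End lebesgue_rV.

Definition ae_continuous2 (R : realType) (d : nat)
    (f : 'rV[R]_d -> 'rV[R]_d -> R) : Prop :=
  {ae (lebesgue_rV R d \x lebesgue_rV R d)%E, forall z : 'rV[R]_d * 'rV[R]_d,
    {for z, continuous (fun z : 'rV[R]_d * 'rV[R]_d => f z.1 z.2)}}.

Section conditioning.
Context {R : realType} {disp : measure_display} {Omega : measurableType disp}.
Variable P : probability Omega R.
Implicit Types (F G : set (set Omega)) (E : set Omega) (f g h : Omega -> R).

(* [g] is a version of the conditional expectation of the integrable random
   variable [f] given the sub-sigma-algebra [G]. *)
Definition cond_exp_version G f g : Prop :=
  [/\ forall S, measurable S -> G (g @^-1` S),
      P.-integrable setT (EFin \o g) &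
      forall C, G C ->
        (\int[P]_(w in C) (g w)%:E = \int[P]_(w in C) (f w)%:E)%E].

(* [E[f | G] = h] almost surely; [h] itself need only agree with a
   [G]-measurable function outside a [P]-negligible set, so that the statement
   makes sense for [h] built from functions that are Lebesgue measurable but not
   Borel measurable. *)
Definition cond_exp_is G f h : Prop :=
  exists2 g, cond_exp_version G f g & {ae P, forall w, g w = h w}.

Definition cond_prob_version G E g : Prop := cond_exp_version G (\1_E) g.

Definition cond_prob_is G E h : Prop := cond_exp_is G (\1_E) h.

Definition sigma_join F G : set (set Omega) := <<s F `|` G >>.

(* For a family indexed by a finite type, the product rule over all subfamilies
   follows from the one over the full family, as any [S i] may be [setT]. *)
Definition mutually_independent (I : finType) d' (T : measurableType d')
    (X : I -> Omega -> T) : Prop :=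
  forall S : I -> set T, (forall i, measurable (S i)) ->
    (P (\bigcap_i (X i @^-1` S i)) = \big[*%E/1%E]_i P (X i @^-1` S i))%E.

Definition independent_of d' (T : measurableType d') (X : Omega -> T) G : Prop :=
  forall S C, measurable S -> G C ->
    (P (X @^-1` S `&` C) = P (X @^-1` S) * P C)%E.

Definition mutually_cond_independent (I : finType) d' (T : measurableType d')
    G (X : I -> Omega -> T) : Prop :=
  forall S : I -> set T, (forall i, measurable (S i)) ->
    exists2 q : I -> Omega -> R,
      forall i, cond_prob_version G (X i @^-1` S i) (q i) &
      cond_prob_is G (\bigcap_i (X i @^-1` S i)) (fun w => \prod_i q i w).

Definition traj d' (T : measurableType d') (X : nat -> {RV P >-> T}) (s : nat)
    (w : Omega) : s.+1.-tuple T :=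
  [tuple X u w | u < s.+1].

Definition cond_markov_chain d' (T : measurableType d') G
    (X : nat -> {RV P >-> T}) (t : nat) : Prop :=
  forall s S, (s < t)%N -> measurable S ->
    exists2 g,
      cond_prob_version (sigma_join G (g_sigma_algebra_preimage (X s)))
        (X s.+1 @^-1` S) g &
      cond_prob_is (sigma_join G (g_sigma_algebra_preimage (traj X s)))
        (X s.+1 @^-1` S) g.

(* [P(E | G, X = a) = h] almost surely on the event [X = a] *)
Definition cond_prob_at_is d' (T : measurableType d') G E (X : Omega -> T)
    (a : T) h : Prop :=
  exists2 g, cond_prob_version (sigma_join G (g_sigma_algebra_preimage X)) E g &
    {ae P, forall w, X w = a -> g w = h w}.

End conditioning.

Section model.
Variables (R : realType) (d : nat) (gamma : R).
Let V := 'rV[R]_d.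
Variables (B : bool -> V -> V -> R) (B0 : V -> V -> R).
Variables (mu0 noise : probability V R).

Definition Bhat (p : R) (x y : V) : R := p * B true x y + (1 - p) * B false x y.

Fixpoint Btraj (s : nat) (z1 z2 : seq V) : R :=
  if s is u.+1 then Bhat (Btraj u z1 z2) z1`_s z2`_s else B0 z1`_0 z2`_0.

(* [mu] stands for the law of a trajectory. The library integral of a nonnegative
   function is a supremum over measurable simple functions below it, hence agrees
   with the integral against the completion of [mu]; integrability is therefore
   expressed through finiteness of the integral of the absolute value, rather
   than with [integrable], which would require Borel measurability. *)
Section drift.
Variables (s : nat) (mu : set (s.+1.-tuple V) -> \bar R) (x : s.+1.-tuple V).

Definition drift_num (j : 'I_d) : \bar R :=
  (\int[mu]_z (z`_s ord0 j * Btraj s x z)%:E)%E.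

Definition drift_den : \bar R := (\int[mu]_z (Btraj s x z)%:E)%E.

Definition drift_defined : Prop :=
  drift_den != 0%E /\
  forall j : 'I_d, (\int[mu]_z `|z`_s ord0 j * Btraj s x z|%:E < +oo)%E.

Definition drift : V := \row_j (fine (drift_num j) / fine drift_den).

End drift.

Variables (k t : nat).

Definition edge : Type := {e : 'I_k * 'I_k | (e.1 < e.2)%N}.
HB.instance Definition _ := Finite.on edge.

(* Processes are indexed by [nat], but only their values at times up to [t]
   (up to [t - 1] for the noise) are constrained or observed. *)
Section processes.
Context {disp : measure_display} {Omega : measurableType disp}.
Variable P : probability Omega R.
Variables (Z : 'I_k -> nat -> {RV P >-> V}).
Variables (A : 'I_k -> 'I_k -> nat -> {RV P >-> bool}).

Definition Zpath (s : nat) (w : Omega) : k.-tuple (s.+1.-tuple V) :=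
  [tuple traj (Z i) s w | i < k].

Definition Apath (s : nat) (w : Omega) :
    k.-tuple (k.-tuple (s.+1.-tuple bool)) :=
  [tuple [tuple traj (A i j) s w | j < k] | i < k].

Definition sigF (s : nat) : set (set Omega) :=
  g_sigma_algebra_preimage (fun w => (Zpath s w, Apath s w)).

Definition sigG (s : nat) : set (set Omega) :=
  g_sigma_algebra_preimage (Zpath s).

Definition sigGA (s : nat) : set (set Omega) :=
  if s is u.+1 then g_sigma_algebra_preimage (fun w => (Zpath s w, Apath u w))
  else sigG 0.

Definition edge_prob (i j : 'I_k) (s : nat) (w : Omega) : R :=
  if s is u.+1 then B (A i j u w) (Z i s w) (Z j s w)
  else B0 (Z i 0 w) (Z j 0 w).

Definition noise_family (xi : 'I_k -> nat -> {RV P >-> V})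
    (p : 'I_k * 'I_t) : Omega -> V := xi p.1 p.2.

Definition noise_vector (xi : 'I_k -> nat -> {RV P >-> V}) (s : nat)
    (w : Omega) : k.-tuple V := [tuple xi i s w | i < k].

Definition Z_dynamics (i1 : 'I_k) (xi : 'I_k -> nat -> {RV P >-> V}) : Prop :=
  let mu s := pushforward P (traj (Z i1) s) in
  forall i s, (s < t)%N ->
    {ae P, forall w, drift_defined (mu s) (traj (Z i) s w) /\
      Z i s.+1 w = (1 - gamma) *: Z i s w
                   + gamma *: drift (mu s) (traj (Z i) s w) + xi i s w}.

Record common_requirements (i1 : 'I_k) : Prop := CommonRequirements {
  Z0_independent : mutually_independent P (fun i : 'I_k => Z i 0);
  Z0_law : forall i S, measurable S -> P (Z i 0 @^-1` S) = mu0 S;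
  Z_solves : exists xi : 'I_k -> nat -> {RV P >-> V},
    [/\ Z_dynamics i1 xi,
        mutually_independent P (noise_family xi),
        forall i s S, (s < t)%N -> measurable S ->
          P (xi i s @^-1` S) = noise S &
        forall s, (s < t)%N -> independent_of P (noise_vector xi s) (sigF s)];
  A_cond_mean : forall i j s, i != j -> (s <= t)%N ->
    cond_exp_is P (sigGA s) (fun w => (A i j s w)%:R) (edge_prob i j s);
  A_symmetric : forall i j s, (s <= t)%N -> {ae P, forall w, A i j s w = A j i s w};
  A_diagonal : forall i s, (s <= t)%N -> {ae P, forall w, A i i s w = true}
}.

Definition stepwise_cond_indep : Prop :=
  forall s, (s <= t)%N ->
    mutually_cond_independent P (sigGA s)
      (fun e : edge => A (val e).1 (val e).2 s).

Definition cond_indep_markov_chains : Prop :=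
  mutually_cond_independent P (sigG t)
    (fun e : edge => traj (A (val e).1 (val e).2) t) /\
  forall i j : 'I_k, (i < j)%N ->
    [/\ cond_markov_chain (sigG t) (A i j) t,
        cond_prob_is P (sigG t) (A i j 0 @^-1` [set true])
          (fun w => B0 (Z i 0 w) (Z j 0 w)) &
        forall s a, (s < t)%N ->
          cond_prob_at_is P (sigG t) (A i j s.+1 @^-1` [set true]) (A i j s) a
            (fun w => B a (Z i s.+1 w) (Z j s.+1 w))].

Definition pathwise_cond_indep : Prop :=
  forall s, (s <= t)%N ->
    mutually_cond_independent P (sigG s)
      (fun e : edge => traj (A (val e).1 (val e).2) s).

End processes.

Let path_space : Type :=
  (k.-tuple (t.+1.-tuple V) * k.-tuple (k.-tuple (t.+1.-tuple bool)))%type.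

Let pair_condition : Type :=
  forall (disp : measure_display) (Omega : measurableType disp)
    (P : probability Omega R),
  ('I_k -> nat -> {RV P >-> V}) -> ('I_k -> 'I_k -> nat -> {RV P >-> bool}) ->
  Prop.

(* [m] is the law of [(Z^(1:k)[t], A^(1:k,1:k)[t])] for some pair, on some
   probability space, satisfying the common requirements and [C]. *)
Definition is_joint_law (i1 : 'I_k) (C : pair_condition)
    (m : probability path_space R) : Prop :=
  exists (disp : measure_display) (Omega : measurableType disp)
    (P : probability Omega R) (Z : 'I_k -> nat -> {RV P >-> V})
    (A : 'I_k -> 'I_k -> nat -> {RV P >-> bool}),
  [/\ common_requirements Z A i1,
      C disp Omega P Z A &
      forall S : set path_space, measurable S ->
        P ((fun w => (Zpath Z t w, Apath A t w)) @^-1` S) = m S].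

(* Uniqueness of the law only: whether a pair exists depends on the quotient
   defining the drift being well defined, which the data do not guarantee. *)
Definition characterizes_joint_law (i1 : 'I_k) (C : pair_condition) : Prop :=
  forall m m' : probability path_space R,
    is_joint_law i1 C m -> is_joint_law i1 C m' ->
    forall S : set path_space, measurable S -> m S = m' S.

End model.

Arguments stepwise_cond_indep {R d k} t disp Omega P Z A.
Arguments cond_indep_markov_chains {R d} B B0 {k} t disp Omega P Z A.
Arguments pathwise_cond_indep {R d k} t disp Omega P Z A.
Arguments is_joint_law {R d} gamma B B0 mu0 noise {k} t i1 C m.
Arguments characterizes_joint_law {R d} gamma B B0 mu0 noise {k} t i1 C.

(* Main.v *)
(** Conditionally on the states, every edge runs through a time-inhomogeneous
    two-state Markov chain, the edges being independent of each other. All three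
    conditional structures amount to the formula
      P(A_e[s] = a_e for all edges e | G_s) = prod_e w_e(a_e),  s <= t,   (L)
    where w_e(a) is the product of the transition weights of the chain of e along
    the path a. What makes this work is that, given Z[s], the next state Z(s+1) is a
    function of Z[s] and of noise independent of F_s; hence events of F_s have the
    same conditional probability given G_s and given G_(s+1), ..., G_t. This
    determines the conditional law of a single edge, so that conditional
    independence alone, at time t or at each time, is equivalent to (L); it is also
    what turns the stepwise structure into (L), by induction on s. Finally (L)
    reduces the joint law to the law of Z[t], which is determined recursively, as
    the drift only depends on the law of the preceding path.

    The kernels are merely a.e. continuous, and may fail to be Borel. They agree
    with Borel kernels off a null set N of pairs; the laws of Z_i(s) and of the
    pairs (Z_i(s), Z_j(s)), i <> j, are absolutely continuous because of the noise,
    so that N is almost surely not met. *)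

Require Import Defs.
From HB Require Import structures.
From mathcomp Require Import all_boot all_order all_algebra.
From mathcomp Require Import all_classical all_reals all_analysis.
From mathcomp Require Import measurable_realfun.

Set Implicit Arguments.
Unset Strict Implicit.
Unset Printing Implicit Defensive.

Import Order.TTheory GRing.Theory Num.Theory.
Import numFieldNormedType.Exports.

Local Open Scope classical_set_scope.
Local Open Scope ring_scope.

(** * Conditional probabilities *)

(** Passing to Borel kernels looks circular: the recursion can be rewritten with them only once the
    states up to time s are known to avoid null sets, and this is learnt from the recursion.
    Absolute continuity is therefore carried along by induction on time. Two kinds of pairs must
    avoid N. In the drift, a state is paired with a separate integration variable, so absolute
    continuity of single states is enough; in the edge probabilities, two distinct particles are
    paired, and the independence of their noises enters. The drift of the given kernels may
    integrate a non-measurable function, but its value still ignores null sets. The way back from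
    (L) to (a) has its own obstacle: the conditioning there contains the whole adjacency matrix,
    whereas (L) speaks of the edges i < j. The edge paths are finitely many, so their events form a
    finite partition, on each part of which symmetry and the diagonal fix the adjacency path almost
    surely; it is enough to test on the parts. The same device, for one edge, gives the Markov
    property in (b). *)

Section sub_sigma_algebras.
Context {disp : measure_display} {Omega : measurableType disp}.
Implicit Types G H : set (set Omega).

Definition subsigma G := sigma_algebra setT G /\ G `<=` measurable.

(** Phrased through the measurable type generated by [G], so that the closure properties of
    measurable functions apply to sub-sigma-algebras as they stand. *)
Definition measurable_wrt G d' (T : measurableType d') (X : Omega -> T) :=
  measurable_fun [set: g_sigma_algebraType G] X.

Lemma measurable_wrtP G d' (T : measurableType d') (X : Omega -> T) :
  subsigma G ->
  measurable_wrt G X <-> (forall S, measurable S -> G (X @^-1` S)).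
Proof.
move=> [sG _]; split.
  by move=> mX S mS; have := mX measurableT _ mS;
    rewrite setTI/= -[X in X _]/(<<s G >>) sigma_algebra_id.
by move=> mX _ S mS; rewrite setTI; apply: sub_sigma_algebra; exact: mX.
Qed.

Lemma measurable_wrt_sub G H d' (T : measurableType d') (X : Omega -> T) :
  G `<=` H -> measurable_wrt G X -> measurable_wrt H X.
Proof.
move=> GH mX _ S mS; move: (mX measurableT _ mS); apply: smallest_sub.
  exact: smallest_sigma_algebra.
by move=> C /GH; exact: sub_sigma_algebra.
Qed.

Lemma measurable_wrtW G d' (T : measurableType d') (X : Omega -> T) :
  subsigma G -> measurable_wrt G X -> measurable_fun setT X.
Proof.
by move=> sG /(measurable_wrtP _ sG) mX _ S mS; rewrite setTI; apply: sG.2; exact: mX.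
Qed.

Lemma subsigmaT G : subsigma G -> G setT.
Proof. by move=> [[G0 GC _] _]; rewrite -setC0 -setTD; exact: GC. Qed.

Lemma subsigmaI G A B : subsigma G -> G A -> G B -> G (A `&` B).
Proof.
move=> [sG _] GA GB; have := @measurableI _ (g_sigma_algebraType G) A B
  (@sub_sigma_algebra _ setT G _ GA) (@sub_sigma_algebra _ setT G _ GB).
by rewrite -[X in X _]/(<<s G >>) sigma_algebra_id.
Qed.

Lemma subsigma_preimage d' (T : measurableType d') (X : Omega -> T) :
  measurable_fun setT X -> subsigma (g_sigma_algebra_preimage X).
Proof.
move=> mX; split; first exact/sigma_algebra_preimage/sigma_algebra_measurable.
by move=> _ [S mS <-]; exact: mX.
Qed.

Lemma measurable_wrt_preimage d' (T : measurableType d') (X : Omega -> T) :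
  measurable_wrt (g_sigma_algebra_preimage X) X.
Proof. exact: preimage_set_system_measurable_fun. Qed.

End sub_sigma_algebras.

Section conditional_probability.
Context {R : realType} {disp : measure_display} {Omega : measurableType disp}.
Variable P : probability Omega R.
Implicit Types (G H : set (set Omega)) (E : set Omega) (f g h : Omega -> R).

(* f is a version of P(E | G). *)
Record cprob G E f : Prop := CProb {
  cprob_meas : measurable_wrt G f;
  cprob_ge0 : forall w, 0 <= f w;
  cprobE : forall C, G C -> P (E `&` C) = (\int[P]_(w in C) (f w)%:E)%E
}.

Import HBNNSimple.

(** The identity defining [cprob] is the case of an indicator; monotone convergence along simple
    functions extends it to nonnegative [h]. The simple functions are built on
    [g_sigma_algebraType G], so that their level sets lie in [G]. *)
Lemma cprob_integral G E f h : subsigma G -> measurable E ->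
  cprob G E f -> measurable_wrt G h -> (forall w, 0 <= h w) ->
  (\int[P]_(w in E) (h w)%:E = \int[P]_w (h w * f w)%:E)%E.
Proof.
move=> sG mE [fG f0 fE] hG h0.
have mf : measurable_fun setT f := measurable_wrtW sG fG.
pose h' : g_sigma_algebraType G -> R := h.
have mhG : measurable_fun [set: g_sigma_algebraType G] (EFin \o h').
  exact/measurable_EFinP.
pose a := nnsfun_approx measurableT mhG.
have aG n S : measurable S -> G (a n @^-1` S).
  move=> mS; have /(measurable_wrtP _ sG)/(_ S mS) := @measurable_funPT _ _ _ _ (a n).
  by [].
have ma n : measurable_fun [set: Omega] (a n : Omega -> R).
  by move=> _ S mS; rewrite setTI; apply: sG.2; exact: aG.
have acvg w : ((a n w)%:E @[n --> \oo] --> (h w)%:E)%E.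
  by apply: (@cvg_nnsfun_approx _ _ _ _ measurableT _ mhG) => // x _; rewrite lee_fin.
have and' w : {homo (fun n => a n w) : m n / (m <= n)%N >-> m <= n}.
  by move=> m n mn; apply/lefP/nd_nnsfun_approx.
transitivity (limn (fun n => \int[P]_(w in E) (a n w)%:E)%E).
  rewrite -monotone_convergence//.
  - by apply: eq_integral => w _; apply/esym/cvg_lim => //; exact: acvg.
  - by move=> n; apply/measurable_EFinP; apply: measurable_funTS; exact: ma.
  - by move=> n w _; rewrite lee_fin.
  - by move=> w _ m n mn; rewrite lee_fin; exact: and'.
transitivity (limn (fun n => \int[P]_w (a n w * f w)%:E)%E); last first.
  rewrite -monotone_convergence//.
  - apply: eq_integral => w _; apply/cvg_lim => //.
    under eq_fun do rewrite EFinM.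
    by rewrite EFinM; apply: cvgeZr => //; exact: acvg.
  - move=> n; apply/measurable_EFinP; apply: measurable_funM => //; exact: ma.
  - by move=> n w _; rewrite lee_fin mulr_ge0.
  - move=> w _ m n mn; rewrite lee_fin ler_wpM2r//; exact: and'.
congr (limn _); apply/funext => n.
have mS r : measurable ((a n : Omega -> R) @^-1` [set r]).
  by rewrite -[X in measurable X]setTI; exact: ma.
(* A nonnegative function has empty level sets at negative values, so every term of its
   decomposition is nonnegative. *)
have i0 r w : 0 <= r * \1_((a n : Omega -> R) @^-1` [set r]) w.
  have [r0|r0] := leP 0 r; first by rewrite mulr_ge0.
  rewrite indicE; case: (boolP (w \in _)) => /=; last by rewrite mulr0.
  rewrite inE /= => aw; have : 0 <= a n w by [].
  by rewrite aw leNgt r0.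
under eq_integral => w _ do rewrite (fimfunE (a n)) -fsumEFin//.
have mi (D : set Omega) r :
    measurable_fun D (\1_((a n : Omega -> R) @^-1` [set r]) : Omega -> R).
  exact: measurable_indic.
rewrite ge0_integral_fsum//; last 2 first.
  - by move=> r; apply/measurable_EFinP; apply: measurable_funM.
  - by move=> r w _; rewrite lee_fin.
under [RHS]eq_integral => w _.
  rewrite (fimfunE (a n)) EFinM -fsumEFin// ge0_mule_fsuml; last first.
    by move=> r; rewrite lee_fin.
  over.
rewrite ge0_integral_fsum//; last 2 first.
  - move=> r; apply: emeasurable_funM; last exact/measurable_EFinP.
    by apply/measurable_EFinP; apply: measurable_funM.
  - by move=> r w _; rewrite mule_ge0 ?lee_fin.
apply: eq_fsbigr => r; rewrite inE => -[w0 _ r0].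
have r_ge0 : 0 <= r by rewrite -r0.
under eq_integral do rewrite EFinM.
rewrite ge0_integralZl//; last exact/measurable_EFinP.
under [RHS]eq_integral do rewrite EFinM -muleA.
rewrite ge0_integralZl//; last 2 first.
  - by apply: emeasurable_funM; exact/measurable_EFinP.
  - by move=> w _; rewrite mule_ge0 ?lee_fin.
congr (_ * _)%E.
rewrite integral_indic; [|exact: mE|exact: mS].
transitivity (\int[P]_(w in (a n : Omega -> R) @^-1` [set r]) (f w)%:E)%E.
  by rewrite setIC; exact: (fE _ (aG n _ (measurable_set1 r))).
rewrite [LHS]integral_mkcond.
apply: eq_integral => w _.
by rewrite /patch indicE; case: ifPn => _; rewrite ?mul1e ?mul0e.
Qed.


Lemma cprob_setI_integral G E f h C : subsigma G -> measurable E ->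
  cprob G E f -> measurable_wrt G h -> (forall w, 0 <= h w) -> G C ->
  (\int[P]_(w in E `&` C) (h w)%:E = \int[P]_(w in C) (h w * f w)%:E)%E.
Proof.
move=> sG mE Ef hG h0 GC.
have mC : measurable C by exact: sG.2.
rewrite integral_mkcondr [RHS]integral_mkcond.
transitivity (\int[P]_(w in E) (h w * \1_C w)%:E)%E.
  apply: eq_integral => w _; rewrite /patch indicE.
  by case: ifPn => _; rewrite ?mulr1 ?mulr0.
rewrite (cprob_integral sG mE Ef); last 2 first.
  - apply: measurable_funM => //; apply: measurable_indic.
    exact: sub_sigma_algebra.
  - by move=> w; rewrite mulr_ge0.
apply: eq_integral => w _; rewrite /patch indicE.
by case: ifPn => _; rewrite ?mulr1 ?mulr0 ?mul0r.
Qed.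

(* One step of a conditional chain: E is known with conditional probability f
   given G, and D has conditional probability h given a larger H, where h
   agrees on E with the G-measurable g. *)
Lemma cprobI G H E D f g h : subsigma G -> subsigma H -> G `<=` H ->
  H E -> measurable D -> cprob G E f -> cprob H D h ->
  measurable_wrt G g -> (forall w, 0 <= g w) ->
  {ae P, forall w, E w -> h w = g w} ->
  cprob G (E `&` D) (fun w => f w * g w).
Proof.
move=> sG sH GH HE mD Ef Dh mg g0 hg; have [mf f0 _] := Ef.
have mE : measurable E by exact: sH.2.
split; first exact: measurable_funM.
  by move=> w; rewrite mulr_ge0.
move=> C GC; have mC : measurable C by exact: sG.2.
have HEC : H (E `&` C).
  by apply: (subsigmaI sH) => //; exact: GH.
(* [E] is moved to the side of [C]: their intersection lies in [H], over which [h] gives the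
   probability of [D]. *)
rewrite -setIA (setIC D) setIA setIC (cprobE Dh)//.
transitivity (\int[P]_(w in E `&` C) (g w)%:E)%E.
  apply: ge0_ae_eq_integral => //.
  - exact: measurableI.
  - apply/measurable_EFinP/measurable_funTS/(measurable_wrtW sH).
    exact: cprob_meas Dh.
  - exact/measurable_EFinP/measurable_funTS/(measurable_wrtW sG).
  - by move=> w _; rewrite lee_fin; exact: cprob_ge0 Dh w.
  - by move=> w _; rewrite lee_fin.
  - by apply: filterS hg => w hg [/hg ->].
rewrite (cprob_setI_integral sG mE Ef)//.
by apply: eq_integral => w _; rewrite mulrC.
Qed.

End conditional_probability.

Section conditional_probability_versions.
Context {R : realType} {disp : measure_display} {Omega : measurableType disp}.
Variable P : probability Omega R.
Implicit Types (G H : set (set Omega)) (E : set Omega) (f g h : Omega -> R).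

Lemma integral_indicE E C : measurable E -> measurable C ->
  (\int[P]_(w in C) (\1_E w)%:E = P (E `&` C))%E.
Proof. by move=> mE mC; rewrite integral_indic. Qed.

Lemma cprob_integrable G E f : subsigma G -> measurable E -> cprob P G E f ->
  P.-integrable setT (EFin \o f).
Proof.
move=> sG mE [mf f0 fE]; apply/integrableP; split.
  exact/measurable_EFinP/(measurable_wrtW sG).
under eq_integral do rewrite /= ger0_norm//.
have GT := subsigmaT sG.
by rewrite -fE// setIT ltey_eq fin_num_measure.
Qed.

Lemma cprob_version G E f : subsigma G -> measurable E -> cprob P G E f ->
  cond_prob_version P G E f.
Proof.
move=> sG mE Ef; have [mf f0 fE] := Ef; split.
- exact/(measurable_wrtP _ sG).
- exact: cprob_integrable mE Ef.
- by move=> C GC; rewrite -fE// integral_indicE//; exact: sG.2.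
Qed.

(** The set where [g] exceeds [h] lies in [G], so that [g] and [h] have the same integral over it;
    as their difference is positive there, the set is null. *)
Lemma cond_exp_version_le G f g h : subsigma G ->
  cond_exp_version P G f g -> cond_exp_version P G f h ->
  {ae P, forall w, g w <= h w}.
Proof.
move=> sG [mg ig gE] [mh ih hE].
have {}mg : measurable_wrt G g by exact/(measurable_wrtP _ sG).
have {}mh : measurable_wrt G h by exact/(measurable_wrtP _ sG).
have mgh : measurable_wrt G (g \- h)%R by exact: measurable_funB.
pose C := (g \- h)%R @^-1` `]0, +oo[%classic.
have GC : G C.
  by move/(measurable_wrtP _ sG) : mgh; apply; exact: measurable_itv.
have mC : measurable C by exact: sG.2.
have igC : P.-integrable C (EFin \o g) by exact: integrableS ig.
have ihC : P.-integrable C (EFin \o h) by exact: integrableS ih.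
have mghT : measurable_fun C (EFin \o (g \- h)%R).
  by apply/measurable_EFinP/measurable_funTS; exact: measurable_wrtW sG mgh.
have I0 : (\int[P]_(w in C) `|(EFin \o (g \- h)%R) w| = 0)%E.
  transitivity (\int[P]_(w in C) ((g w)%:E - (h w)%:E))%E.
    apply: eq_integral => w; rewrite inE /C /= in_itv/= andbT => gh0.
    by rewrite ger0_norm ?EFinB// ltW.
  rewrite integralB_EFin// gE// hE// subee//.
  by rewrite -hE//; exact: integrable_fin_num.
move/(ae_eq_integral_abs _ mC mghT) : I0; apply: filterS => w /= Cw.
rewrite leNgt; apply/negP => hg.
have Cw' : C w by rewrite /C /= in_itv/= andbT subr_gt0.
by have /= := Cw Cw' => -[]; apply/eqP; rewrite gt_eqF// subr_gt0.
Qed.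

Lemma cond_exp_version_unique G f g h : subsigma G ->
  cond_exp_version P G f g -> cond_exp_version P G f h ->
  {ae P, forall w, g w = h w}.
Proof.
move=> sG vg vh; have gh := cond_exp_version_le sG vg vh.
have hg := cond_exp_version_le sG vh vg.
by apply: filterS2 gh hg => w gh hg; apply/eqP; rewrite eq_le gh.
Qed.

(** The way in from the requirements of the model: [h], built from the given kernels, may fail to be
    measurable, and an almost surely equal [G]-measurable [f] takes its place. *)
Lemma cond_prob_is_cprob G E f h : subsigma G -> measurable E ->
  cond_prob_is P G E h -> measurable_wrt G f -> (forall w, 0 <= f w) ->
  {ae P, forall w, h w = f w} -> cprob P G E f.
Proof.
move=> sG mE [g [mg ig gE] gh] mf f0 hf; split => // C GC.
have mC : measurable C by exact: sG.2.
rewrite -integral_indicE// -gE//; apply: ae_eq_integral => //.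
- by apply: measurable_funTS; exact: measurable_int ig.
- exact/measurable_EFinP/measurable_funTS/(measurable_wrtW sG).
- by apply: filterS2 gh hf => w -> -> _.
Qed.

Lemma cprob_cond_prob_is G E f h : subsigma G -> measurable E ->
  cprob P G E f -> {ae P, forall w, f w = h w} -> cond_prob_is P G E h.
Proof. by move=> sG mE Ef fh; exists f => //; exact: cprob_version. Qed.

Lemma cprob_tower G H E f : G `<=` H -> cprob P H E f -> measurable_wrt G f ->
  cprob P G E f.
Proof. by move=> GH [_ f0 fE] mf; split => // C /GH; exact: fE. Qed.

Lemma measure_bigcup_finType (I : finType) (p : pred I) (E : I -> set Omega) :
  (forall i, measurable (E i)) -> trivIset setT E ->
  (P (\bigcup_(i in [set` p]) E i) = \sum_(i | p i) P (E i))%E.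
Proof.
move=> mE tE; have <- : [set` enum p] = [set` p].
  by apply/seteqP; split => i /=; rewrite mem_enum.
rewrite measure_fin_bigcup//; last exact: sub_trivIset tE.
by rewrite -fsbig_seq ?enum_uniq// big_enum.
Qed.

Lemma cprob_sum G (I : finType) (p : pred I) (E : I -> set Omega)
    (f : I -> Omega -> R) : subsigma G -> (forall i, measurable (E i)) ->
  trivIset setT E -> (forall i, p i -> cprob P G (E i) (f i)) ->
  cprob P G (\bigcup_(i in [set` p]) E i) (fun w => \sum_(i | p i) f i w).
Proof.
move=> sG mE tE fE; split.
- rewrite /measurable_wrt; under eq_fun do rewrite big_mkcond.
  apply: (@measurable_sum _ (g_sigma_algebraType G)) => i.
  by case: (boolP (p i)) => [/fE[mf _ _]|_] //; exact: measurable_cst.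
- by move=> w; rewrite sumr_ge0// => i /fE[_ /(_ w)].
- move=> C GC; have mC : measurable C by exact: sG.2.
  under eq_integral do rewrite -sumEFin big_mkcond.
  rewrite ge0_integral_sum//; last 2 first.
  + move=> i; case: (boolP (p i)) => [/fE[mf _ _]|_]; last exact: measurable_cst.
    exact/measurable_EFinP/measurable_funTS/(measurable_wrtW sG).
  + by move=> i w _; case: ifPn => // /fE[_ /(_ w)]; rewrite lee_fin.
  rewrite setI_bigcupl measure_bigcup_finType; last 2 first.
  + by move=> k; exact: measurableI.
  + apply/trivIsetP => k l _ _ kl; rewrite setIACA setIid.
    by move/trivIsetP : tE => /(_ _ _ _ _ kl) ->; rewrite ?set0I.
  rewrite big_mkcond/=; apply: eq_bigr => k _.
  by case: (boolP (p k)) => [/fE[_ _ ->]//|_]; rewrite integral0.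
Qed.

(** Dynkin induction. Complements are handled by subtraction from the identity over the whole space,
    hence the premise [GG setT]; the probabilities being finite, the subtraction is licit. *)
Lemma cprob_generated (GG : set (set Omega)) E f : GG `<=` measurable ->
  setI_closed GG -> measurable E -> measurable_wrt <<s GG >> f ->
  (forall w, 0 <= f w) -> GG setT ->
  (forall C, GG C -> P (E `&` C) = \int[P]_(w in C) (f w)%:E)%E ->
  cprob P <<s GG >> E f.
Proof.
move=> mGG IGG mE mf f0 GGT GGE; split => //.
have sG : subsigma <<s GG >>.
  split; first exact: smallest_sigma_algebra.
  by apply: smallest_sub => //; exact: sigma_algebra_measurable.
have mfT := measurable_wrtW sG mf.
have mfE (D : set Omega) : measurable_fun D (EFin \o f).
  exact/measurable_EFinP/measurable_funTS.
have {}f0 w : (0 <= (f w)%:E)%E by rewrite lee_fin.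
apply: (@dynkin_induction _ (g_sigma_algebraType GG) GG
  (fun C => P (E `&` C) = \int[P]_(w in C) (f w)%:E)%E) => //.
- exact: GGE.
- move=> C /sG.2 mC IC.
  have PE := GGE _ GGT.
  have := @ge0_integral_setU _ _ _ P C (~` C) mC (measurableC mC) _ (mfE _) (fun w _ => f0 w).
  rewrite setUv -PE setIT -IC disj_set2E setICr eqxx => /(_ isT) PC.
  have : (P (E `&` C) + P (E `&` ~` C) = P (E `&` C) + \int[P]_(w in ~` C) (f w)%:E)%E.
    rewrite -PC -measureU//; last 3 first.
    + exact: measurableI.
    + by apply: measurableI => //; exact: measurableC.
    + by rewrite setIACA setICr setI0.
    by rewrite -setIUr setUv setIT.
  have fin : P (E `&` C) \is a fin_num by rewrite fin_num_measure//; exact: measurableI.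
  by move/(congr1 (fun x => x - P (E `&` C))%E); rewrite ![(P (E `&` C) + _)%E]addeC !addeK.
- move=> F mF tF FE.
  have {}mF n : measurable (F n : set Omega) by exact: (sG.2 _ (mF n)).
  rewrite setI_bigcupr measure_semi_bigcup//; last 3 first.
  + by move=> n; exact: measurableI.
  + apply/trivIsetP => i j _ _ ij; rewrite setIACA setIid.
    by move/trivIsetP : tF => /(_ _ _ _ _ ij) ->; rewrite ?setI0.
  + by apply: bigcupT_measurable => n; exact: measurableI.
  rewrite ge0_integral_bigcup//.
  by apply: eq_eseriesr => n _; exact: FE.
Qed.

Lemma preimage_pairE d1 d2 (T1 : measurableType d1) (T2 : measurableType d2)
    (X : Omega -> T1) (Y : Omega -> T2) :
  g_sigma_algebra_preimage (fun w => (X w, Y w)) =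
  <<s [set X @^-1` A `&` Y @^-1` B | A in measurable & B in measurable] >>.
Proof.
rewrite /g_sigma_algebra_preimage measurable_prod_measurableType -g_sigma_preimageE.
congr (<<s _ >>); apply/seteqP; split.
  by move=> _ [_ [A mA [B mB <-]] <-]; exists A => //; exists B => //; rewrite setTI.
by move=> _ [A mA [B mB <-]]; exists (A `*` B); [exists A => //; exists B|rewrite setTI].
Qed.

Lemma cprob_pair d1 d2 (T1 : measurableType d1) (T2 : measurableType d2)
    (X : Omega -> T1) (Y : Omega -> T2) E f :
  let G := g_sigma_algebra_preimage (fun w => (X w, Y w)) in
  measurable_fun setT X -> measurable_fun setT Y -> measurable E ->
  measurable_wrt G f -> (forall w, 0 <= f w) ->
  (forall A B, measurable A -> measurable B ->
    P (E `&` (X @^-1` A `&` Y @^-1` B)) =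
    \int[P]_(w in X @^-1` A `&` Y @^-1` B) (f w)%:E)%E ->
  cprob P G E f.
Proof.
move=> G mX mY mE mf f0 IE; rewrite /G preimage_pairE.
apply: cprob_generated => //.
- move=> _ [A mA [B mB <-]]; rewrite -(setTI (X @^-1` _)) -(setTI (Y @^-1` _)).
  by apply: measurableI; [exact: mX|exact: mY].
- move=> _ _ [A mA [B mB <-]] [A' mA' [B' mB' <-]].
  exists (A `&` A'); first exact: measurableI.
  by exists (B `&` B'); [exact: measurableI|rewrite setIACA].
- by rewrite -preimage_pairE.
- by exists setT => //; exists setT => //; rewrite !preimage_setT setTI.
- by move=> _ [A mA [B mB <-]]; exact: IE.
Qed.

End conditional_probability_versions.

(** * Borel versions and null sets *)

Section borel_version.
Context {R : realType}.

(** Labels the cells of the lattice of mesh 1/(n+1) by integer vectors, so that there are countably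
    many of them. *)
Definition grid_floor (n : nat) d (x : 'rV[R]_d) : 'rV[int]_d :=
  \row_j Num.floor (x ord0 j * n.+1%:R).

Definition grid_point (n : nat) d (m : 'rV[int]_d) : 'rV[R]_d :=
  \row_j ((m ord0 j)%:~R / n.+1%:R).

Lemma grid_point_cvg d (x : 'rV[R]_d) :
  (fun n => grid_point n (grid_floor n x)) @ \oo --> x.
Proof.
apply/cvg_ballP => e e0; near=> n; rewrite /ball/=; split => // i j; rewrite ord1 !mxE /ball/=.
have n0 : (0 : R) < n.+1%:R by rewrite ltr0n.
have /andP[f1 f2] := real_floor_itv (num_real (x ord0 j * n.+1%:R)).
rewrite ger0_norm; last by rewrite subr_ge0 ler_pdivrMr.
rewrite ltrBlDl; have : x ord0 j < ((Num.floor (x ord0 j * n.+1%:R)) + 1)%:~R / n.+1%:R.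
  by rewrite ltr_pdivlMr.
move=> /lt_trans; apply; rewrite intrD mulrDl ltrD2l mul1r.
by near: n; exact: (near_infty_natSinv_lt (PosNum e0)).
Unshelve. all: by end_near. Qed.

Lemma measurable_grid_floor n d (m : 'rV[int]_d) :
  measurable ((@grid_floor n d) @^-1` [set m]).
Proof.
rewrite (_ : _ @^-1` _ = \bigcap_(j in [set: 'I_d])
    [set x : 'rV[R]_d | Num.floor (x ord0 j * n.+1%:R) = m ord0 j]); last first.
  apply/seteqP; split => x /=; first by move=> <- j _ /=; rewrite mxE.
  by move=> xm; apply/rowP => j; rewrite mxE; exact: xm.
apply: fin_bigcap_measurable => // j _.
have mj : measurable_fun setT (fun x : 'rV[R]_d => x ord0 j * n.+1%:R).
  by apply: measurable_funM => //; exact: measurable_rV_coord.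
rewrite (_ : [set _ | _] = (fun x : 'rV[R]_d => x ord0 j * n.+1%:R) @^-1`
    `[(m ord0 j)%:~R, (m ord0 j + 1)%:~R[%classic); last first.
  apply/seteqP; split => x /=; rewrite in_itv/=; last exact: floor_def.
  by move=> <-; exact: real_floor_itv (num_real _).
by rewrite -[X in measurable X]setTI; apply: mj => //; exact: measurable_itv.
Qed.

(** Holds for an arbitrary [f], as the step function is constant on each of countably many
    measurable cells. *)
Lemma measurable_grid_step n d (f : 'rV[R]_d -> 'rV[R]_d -> R) :
  measurable_fun setT (fun z : 'rV[R]_d * 'rV[R]_d =>
    f (grid_point n (grid_floor n z.1)) (grid_point n (grid_floor n z.2))).
Proof.
move=> _ S mS; rewrite setTI.
rewrite (_ : _ @^-1` _ = \bigcup_(m : 'rV[int]_d * 'rV[int]_d)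
    if `[< S (f (grid_point n m.1) (grid_point n m.2)) >] then
      ((@grid_floor n d) @^-1` [set m.1] `*` (@grid_floor n d) @^-1` [set m.2])
    else set0); last first.
  apply/seteqP; split => [z /= Sz|z [m _]].
    by exists (grid_floor n z.1, grid_floor n z.2) => //=; rewrite ifT//; exact/asboolP.
  by case: asboolP => // Sm [/= -> ->].
apply: countable_bigcupT_measurable => [|m]; first exact: countableP.
case: ifPn => // _.
by apply: measurableX; exact: measurable_grid_floor.
Qed.

(* The limit of the step functions f o (grid approximation), where it exists
   because of continuity, and 0 elsewhere. *)
Lemma ae_continuous2_borel d (f : 'rV[R]_d -> 'rV[R]_d -> R) :
  ae_continuous2 f -> (forall x y, 0 <= f x y <= 1) ->
  exists (g : 'rV[R]_d -> 'rV[R]_d -> R) (N : set ('rV[R]_d * 'rV[R]_d)),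
    [/\ measurable_fun setT (fun z : 'rV[R]_d * 'rV[R]_d => g z.1 z.2),
    forall x y, 0 <= g x y <= 1,
    measurable N, (lebesgue_rV R d \x lebesgue_rV R d)%E N = 0%E &
    forall x y, ~ N (x, y) -> f x y = g x y].
Proof.
move=> [N [mN N0 fN]] f01.
pose F (z : 'rV[R]_d * 'rV[R]_d) := f z.1 z.2.
exists (fun x y => (F \_ (~` N)) (x, y)), N; split => //.
- under eq_fun do rewrite -surjective_pairing.
  apply/(measurable_restrictT F (measurableC mN)).
  apply: (@measurable_fun_cvg _ _ _ _ (fun n (z : 'rV[R]_d * 'rV[R]_d) =>
    f (grid_point n (grid_floor n z.1)) (grid_point n (grid_floor n z.2)))).
    by move=> n; apply: measurable_funTS; exact: measurable_grid_step.
  move=> z Nz; have cz : {for z, continuous F}.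
    by apply: contrapT => cz; apply: Nz; exact: fN.
  have cq : (fun n => (grid_point n (grid_floor n z.1),
      grid_point n (grid_floor n z.2))) @ \oo --> z.
    case: z {Nz cz} => x y /=.
    exact: (cvg_pair (@grid_point_cvg d x) (@grid_point_cvg d y)).
  by move=> A /cz nA; exact: (cq _ nA).
- by move=> x y; rewrite /patch; case: ifP => _; [exact: f01|rewrite lexx ler01].
- by move=> x y Nxy; rewrite patchT// inE.
Qed.

End borel_version.

(** * Null sets of products, independence and translations *)

Section quasi_invariance.
Local Open Scope ereal_scope.

Definition null_preserving d (T : measurableType d) (R : realType)
    (m : set T -> \bar R) (tau : T -> T) :=
  measurable_fun setT tau /\ forall N, measurable N -> m N = 0 -> m (tau @^-1` N) = 0.

Lemma measurable_xsection_neq0 d1 d2 (T1 : measurableType d1) (T2 : measurableType d2)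
    (R : realType) (m2 : {sigma_finite_measure set T2 -> \bar R}) (N : set (T1 * T2)) :
  measurable N -> measurable [set x | m2 (xsection N x) != 0].
Proof.
move=> mN; rewrite (_ : [set _ | _] = (m2 \o xsection N) @^-1` (~` [set 0])); last first.
  by apply/seteqP; split => x /= /eqP.
rewrite -[X in measurable X]setTI; apply: measurable_fun_xsection => //.
exact: measurableC.
Qed.

(** Tonelli: the product measure integrates the measures of the sections, and a nonnegative function
    has integral zero exactly when it vanishes almost everywhere. *)
Lemma product_null_ae d1 d2 (T1 : measurableType d1) (T2 : measurableType d2)
    (R : realType) (m1 : {sigma_finite_measure set T1 -> \bar R})
    (m2 : {sigma_finite_measure set T2 -> \bar R}) (N : set (T1 * T2)) :
  measurable N ->
  (m1 \x m2) N = 0 <-> m1 [set x | m2 (xsection N x) != 0] = 0.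
Proof.
move=> mN; have mx : measurable_fun setT (m2 \o xsection N).
  exact: measurable_fun_xsection.
have mS : measurable [set x | m2 (xsection N x) != 0].
  exact: measurable_xsection_neq0.
transitivity (\int[m1]_x `|(m2 \o xsection N) x| = 0).
  by under [in X in _ <-> X]eq_integral do rewrite gee0_abs//.
rewrite (ae_eq_integral_abs m1 measurableT mx); split.
  move=> [A [mA A0 hA]]; apply: subset_measure0 A0 => // x /= Nx.
  by apply: hA => /= /(_ I) h; move: Nx; rewrite h eqxx.
move=> S0; exists [set x | m2 (xsection N x) != 0]; split => // x /=.
by move=> h; apply/eqP => h0; apply: h.
Qed.

(** The section at [x] of the preimage of [N] is the [tau2]-preimage of the section of [N] at
    [tau1 x]. Null sections thus stay null, and the exceptional [x] lie in the [tau1]-preimage of a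
    null set. *)
Lemma null_preserving_pair d1 d2 (T1 : measurableType d1) (T2 : measurableType d2)
    (R : realType) (m1 : {sigma_finite_measure set T1 -> \bar R})
    (m2 : {sigma_finite_measure set T2 -> \bar R}) tau1 tau2 :
  null_preserving m1 tau1 -> null_preserving m2 tau2 ->
  null_preserving (m1 \x m2) (fun z => (tau1 z.1, tau2 z.2)).
Proof.
move=> [mt1 t1N] [mt2 t2N].
have mt : measurable_fun setT (fun z : T1 * T2 => (tau1 z.1, tau2 z.2)).
  by apply: measurable_fun_pair; exact: measurableT_comp.
split => // N mN.
have mtN : measurable ((fun z : T1 * T2 => (tau1 z.1, tau2 z.2)) @^-1` N).
  by rewrite -[X in measurable X]setTI; exact: mt.
move=> /(product_null_ae _ _ mN) N0; apply/(product_null_ae _ _ mtN).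
have mx := measurable_xsection_neq0 m2 mN.
apply: subset_measure0 (t1N _ mx N0).
- exact: measurable_xsection_neq0.
- by rewrite -[X in measurable X]setTI; exact: mt1.
- move=> x /=; apply: contra => /eqP Nx; apply/eqP.
  have := t2N _ (measurable_xsection (tau1 x) mN) Nx.
  congr (_ = _); congr (m2 _); apply/seteqP; split => y /=; by rewrite !xsectionE.
Qed.

End quasi_invariance.

Section independence.
Context {R : realType} {disp : measure_display} {Omega : measurableType disp}.
Variable P : probability Omega R.

Definition rv_of d (T : measurableType d) (X : Omega -> T)
    (mX : measurable_fun setT X) : {RV P >-> T} :=
  HB.pack_for {mfun Omega >-> T} X (isMeasurableFun.Build _ _ _ _ X mX).

Definition independent d1 d2 (T1 : measurableType d1) (T2 : measurableType d2)
    (X : Omega -> T1) (Y : Omega -> T2) :=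
  forall A B, measurable A -> measurable B ->
    (P (X @^-1` A `&` Y @^-1` B) = P (X @^-1` A) * P (Y @^-1` B))%E.

Lemma independent_law d1 d2 (T1 : measurableType d1) (T2 : measurableType d2)
    (X : Omega -> T1) (Y : Omega -> T2)
    (mX : measurable_fun setT X) (mY : measurable_fun setT Y) :
  independent X Y -> forall S, measurable S ->
  (P ((fun w => (X w, Y w)) @^-1` S) =
   (distribution P (rv_of mX) \x distribution P (rv_of mY)) S)%E.
Proof.
move=> XY S mS.
rewrite (@product_measure_unique _ _ _ _ _ (distribution P (rv_of mX))
  (distribution P (rv_of mY))
  (distribution P (rv_of (measurable_fun_pair mX mY))))//.
Qed.

(** Freezing: the law of the pair is a product, so an event that is null for every frozen value of
    [X] is null. Below, [X] is a function of the past and [Y] the fresh noise. *)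
Lemma independent_null d1 d2 d3 (T1 : measurableType d1) (T2 : measurableType d2)
    (T3 : measurableType d3) (X : Omega -> T1) (Y : Omega -> T2)
    (g : T1 * T2 -> T3) (N : set T3) :
  measurable_fun setT X -> measurable_fun setT Y -> independent X Y ->
  measurable_fun setT g -> measurable N ->
  (forall x, P (Y @^-1` [set y | N (g (x, y))]) = 0%E) ->
  P ((fun w => g (X w, Y w)) @^-1` N) = 0%E.
Proof.
move=> mX mY XY mg mN N0.
have mgN : measurable (g @^-1` N) by rewrite -[X in measurable X]setTI; exact: mg.
have := independent_law mX mY XY mgN => ->; apply/product_null_ae => //.
rewrite (_ : [set _ | _] = set0) ?measure0//; apply/seteqP; split => // x /=.
apply/negP; rewrite negbK; apply/eqP; rewrite /distribution/= /pushforward/=.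
by rewrite -[RHS](N0 x); congr (P _); apply/seteqP; split => w /=; rewrite xsectionE.
Qed.

End independence.

Section translation.
Context {R : realType}.
Local Open Scope ereal_scope.

Lemma lebesgue_measure_translate (h : R) :
  null_preserving (@lebesgue_measure R) (fun x : measurableTypeR R => h + x)%R.
Proof.
have mt : measurable_fun setT ((fun x => h + x)%R : measurableTypeR R -> measurableTypeR R).
  exact: (@measurable_funD _ (measurableTypeR R) R setT (cst h) id).
split => // N mN N0; rewrite -N0.
pose f : measurableTypeR R -> measurableTypeR R := fun x => (h + x)%R.
(* The pushforward under the translation agrees with Lebesgue measure on half-open intervals, hence
   on all measurable sets. *)
apply/esym; rewrite -[RHS]/(pushforward (@lebesgue_measure R) f N).
apply: lebesgue_measure_unique => //= _ [[a b]] _ <-; rewrite /pushforward.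
rewrite (_ : _ @^-1` _ = `](a - h)%R, (b - h)%R]%classic); last first.
  by apply/seteqP; split => x /=; rewrite !in_itv/= ltrBlDl lerBrDl.
rewrite !lebesgue_measure_itv/= !lte_fin ltrD2r; case: ifP => // _.
by rewrite -!EFinB opprB addrA subrK.
Qed.

Lemma measurable_cons_rV n : measurable_fun setT (@cons_rV R n).
Proof.
apply: measurable_fun_rVP => j.
under eq_fun do rewrite mxE.
case: (unlift ord0 j) => [i|]; last exact: measurable_fst.
exact: (measurableT_comp (measurable_rV_coord i) measurable_snd).
Qed.

Lemma measurable_rV_translate n (h : 'rV[R]_n) :
  measurable_fun setT (fun x => h + x)%R.
Proof.
apply: measurable_fun_rVP => j; under eq_fun do rewrite mxE.
by apply: measurable_funD => //; exact: measurable_rV_coord.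
Qed.

(** [lebesgue_rV] adds one coordinate at a time; through [cons_rV], a translation is the product of
    a translation of the first coordinate and one of the others. *)
Lemma lebesgue_rV_translate n (h : 'rV[R]_n) :
  null_preserving (lebesgue_rV R n) (fun x => h + x)%R.
Proof.
elim: n h => [|n ih] h; (split; first exact: measurable_rV_translate) => N mN.
  move=> N0; rewrite (_ : _ @^-1` N = N)//; apply/seteqP.
  by split => x /=; rewrite (_ : h + x = x)%R//; apply/rowP => -[].
pose tau (p : measurableTypeR R * 'rV[R]_n) : measurableTypeR R * 'rV[R]_n :=
  (h ord0 ord0 + p.1, (\row_i h ord0 (lift ord0 i)) + p.2)%R.
have [_ tauN] : null_preserving (@lebesgue_measure R \x lebesgue_rV R n) tau.
  exact: (null_preserving_pair (lebesgue_measure_translate _) (ih _)).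
rewrite /= /cons_measure /pushforward => /tauN.
rewrite -[X in measurable X]setTI => /(_ (measurable_cons_rV measurableT mN)).
congr (_ = _); congr ((_ \x _) _); apply/seteqP.
have E p : cons_rV (tau p) = (h + cons_rV p)%R.
  apply/rowP => j; rewrite !mxE /tau/=.
  by case: unliftP => [i ->|->]; rewrite ?mxE.
by split => p /=; rewrite E.
Qed.

End translation.

(** * The drift *)

Section null_integral.
Context {R : realType} d (T : measurableType d) (mu : {measure set T -> \bar R}).
Local Open Scope ereal_scope.
Import HBNNSimple.

(* No measurability of f or g is assumed: the integral of a nonnegative function
   is the supremum over the simple functions below it. *)
Let ge0_le_integral_null (N : set T) (f g : T -> \bar R) : measurable N ->
  mu N = 0 -> (forall x, 0 <= f x) -> (forall x, 0 <= g x) ->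
  (forall x, ~ N x -> f x = g x) -> \int[mu]_x f x <= \int[mu]_x g x.
Proof.
move=> mN N0 f0 g0 fg; rewrite !ge0_integralTE//.
apply: ge_ereal_sup => _ [h hf <-].
(* Cutting [h] off on [N] keeps its integral and puts it below [g] everywhere: it is 0 on [N], and
   [f] equals [g] elsewhere. *)
pose h' := proj_nnsfun h (measurableC mN).
have -> : sintegral mu h = sintegral mu h'.
  rewrite -!integralT_nnsfun; apply: ae_eq_integral => //.
  - exact/measurable_EFinP.
  - exact/measurable_EFinP.
  - exists N; split => // x /=; apply: contra_notP => Nx _.
    by rewrite /h' /= mindicE mem_set ?mulr1.
apply: ereal_sup_ubound; exists h' => // x /=.
rewrite mindicE; case: (boolP (x \in _)) => [/set_mem Nx|_].
  by rewrite mulr1 -fg.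
by rewrite mulr0.
Qed.

Lemma integral_null_eq (N : set T) (f g : T -> \bar R) : measurable N ->
  mu N = 0 -> (forall x, ~ N x -> f x = g x) -> \int[mu]_x f x = \int[mu]_x g x.
Proof.
move=> mN N0 fg; rewrite integralE [RHS]integralE.
congr (_ - _); apply/eqP; rewrite eq_le; apply/andP; split;
  apply: (ge0_le_integral_null mN N0) => // x Nx;
  by rewrite ?funeposE ?funenegE fg.
Qed.

End null_integral.

Section parametric_integral.
Context {R : realType} d1 d2 (T1 : measurableType d1) (T2 : measurableType d2).
Variable mu : {sigma_finite_measure set T2 -> \bar R}.

Lemma measurable_parametric_integral (f : T1 * T2 -> \bar R) :
  measurable_fun setT f -> measurable_fun setT (fun x => \int[mu]_y f (x, y))%E.
Proof.
move=> mf; under eq_fun do rewrite integralE.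
apply: emeasurable_funB.
- rewrite (_ : (fun _ => _) = fubini_F mu f^\+%E); last first.
    by apply/funext => x; apply: eq_integral => y _; rewrite !funeposE.
  by apply: measurable_fun_fubini_tonelli_F => //; exact: measurable_funepos.
- rewrite (_ : (fun _ => _) = fubini_F mu f^\-%E); last first.
    by apply/funext => x; apply: eq_integral => y _; rewrite !funenegE.
  by apply: measurable_fun_fubini_tonelli_F => //; exact: measurable_funeneg.
Qed.

End parametric_integral.

Section drift_measurability.
Context {R : realType} {d : nat}.
Local Notation V := 'rV[R]_d.

Lemma measurable_tuple_nth n u : measurable_fun setT (fun x : n.-tuple V => x`_u).
Proof.
have [un|nu] := ltnP u n; last first.
  (* Beyond the length, the default value 0 is returned. *)
  rewrite (_ : (fun _ => _) = cst 0)//; apply/funext => x.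
  by rewrite nth_default// size_tuple.
rewrite (_ : (fun _ => _) = (fun x : n.-tuple V => tnth x (Ordinal un))).
  exact: measurable_tnth.
by apply/funext => x; rewrite (tnth_nth 0).
Qed.

Variables (B : bool -> V -> V -> R) (B0 : V -> V -> R).
Hypothesis mB : forall a, measurable_fun setT (fun z : V * V => B a z.1 z.2).
Hypothesis mB0 : measurable_fun setT (fun z : V * V => B0 z.1 z.2).
Hypothesis B01 : forall a x y, 0 <= B a x y <= 1.
Hypothesis B001 : forall x y, 0 <= B0 x y <= 1.

Lemma Btraj_range s x y : 0 <= Btraj B B0 s x y <= 1.
Proof.
elim: s => [|s /andP[h0 h1]]/=; first exact: B001.
rewrite /Bhat; have /andP[t0 t1] := B01 true x`_s.+1 y`_s.+1.
have /andP[f0 f1] := B01 false x`_s.+1 y`_s.+1.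
rewrite addr_ge0 ?mulr_ge0 ?subr_ge0//=.
rewrite (le_trans (lerD (ler_piMr h0 t1) (ler_piMr _ f1))) ?subr_ge0//.
by rewrite addrC subrK.
Qed.

Lemma measurable_Btraj n s : measurable_fun setT
  (fun z : n.-tuple V * n.-tuple V => Btraj B B0 s z.1 z.2).
Proof.
have mn u : measurable_fun setT (fun z : n.-tuple V * n.-tuple V => (z.1`_u, z.2`_u)).
  apply: measurable_fun_pair.
    exact: (measurableT_comp (@measurable_tuple_nth n u) measurable_fst).
  exact: (measurableT_comp (@measurable_tuple_nth n u) measurable_snd).
elim: s => [|s ih] /=; first exact: (measurableT_comp mB0 (mn 0)).
apply: measurable_funD; apply: measurable_funM => //.
- exact: (measurableT_comp (mB true) (mn s.+1)).
- exact: measurable_funB.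
- exact: (measurableT_comp (mB false) (mn s.+1)).
Qed.

Lemma measurable_drift s (mu : probability (s.+1.-tuple V) R) :
  measurable_fun setT (fun x => drift B B0 mu x).
Proof.
apply: measurable_fun_rVP => j; under eq_fun do rewrite mxE.
have den0 x : 0 <= fine (drift_den B B0 mu x).
  apply: fine_ge0; apply: integral_ge0 => z _; rewrite lee_fin.
  by case/andP: (Btraj_range s x z).
have mnum : measurable_fun setT (fun x => drift_num B B0 mu x j).
  have := @measurable_parametric_integral R _ _ _ _ mu
    (fun z : (s.+1.-tuple V * s.+1.-tuple V)%type =>
      (z.2`_s ord0 j * Btraj B B0 s z.1 z.2)%:E).
  apply; apply/measurable_EFinP; apply: measurable_funM; last exact: measurable_Btraj.
  apply: (measurableT_comp (measurable_rV_coord j)).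
  exact: (measurableT_comp (@measurable_tuple_nth _ s) measurable_snd).
have mden : measurable_fun setT (fun x => drift_den B B0 mu x).
  have := @measurable_parametric_integral R _ _ _ _ mu
    (fun z : (s.+1.-tuple V * s.+1.-tuple V)%type => (Btraj B B0 s z.1 z.2)%:E).
  by apply; apply/measurable_EFinP; exact: measurable_Btraj.
apply: measurable_funM.
  exact: (measurableT_comp (fine_measurable measurableT) mnum).
(* The denominator being nonnegative, its inverse is its real power of exponent -1, even where it is
   0; real powers are measurable. *)
under eq_fun do rewrite -powR_inv1//.
apply: (@measurableT_comp _ _ _ _ _ _ (@powR R ^~ (-1))) => //.
exact: (measurableT_comp (fine_measurable measurableT) mden).
Qed.

End drift_measurability.

Section drift_modification.
Context {R : realType} {d : nat}.
Local Notation V := 'rV[R]_d.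
Variables (B B' : bool -> V -> V -> R) (B0 B0' : V -> V -> R) (N : set (V * V)).
Hypothesis BE : forall a x y, ~ N (x, y) -> B a x y = B' a x y.
Hypothesis B0E : forall x y, ~ N (x, y) -> B0 x y = B0' x y.

Lemma eq_Btraj s (x y : seq V) : (forall u, (u <= s)%N -> ~ N (x`_u, y`_u)) ->
  Btraj B B0 s x y = Btraj B' B0' s x y.
Proof.
elim: s => [|s ih] h /=; first exact/B0E/h.
by rewrite ih ?/Bhat ?BE//; [exact: h..|move=> u us; apply: h; exact: leqW].
Qed.

(** The path [x] is frozen. Only the paths [z] in the null set [M] can meet [N] against it, and
    [integral_null_eq] discards them although the original kernels may fail to be measurable. *)
Lemma eq_drift s (mu : probability (s.+1.-tuple V) R) (x : s.+1.-tuple V)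
    (M : set (s.+1.-tuple V)) : measurable M -> mu M = 0%E ->
  (forall z : s.+1.-tuple V, ~ M z -> forall u, (u <= s)%N -> ~ N (x`_u, z`_u)) ->
  drift B B0 mu x = drift B' B0' mu x.
Proof.
move=> mM M0 MN; apply/rowP => j; rewrite !mxE; congr (fine _ / fine _).
- apply: (integral_null_eq mM M0) => z Mz.
  by rewrite (eq_Btraj (MN _ Mz)).
- apply: (integral_null_eq mM M0) => z Mz.
  by rewrite (eq_Btraj (MN _ Mz)).
Qed.

End drift_modification.

Section almost_sure.
Context {R : realType} {disp : measure_display} {Omega : measurableType disp}.
Variable P : probability Omega R.

Lemma ae_notin_null d (T : measurableType d) (X : Omega -> T) (N : set T) :
  measurable_fun setT X -> measurable N -> P (X @^-1` N) = 0%E ->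
  {ae P, forall w, ~ N (X w)}.
Proof.
move=> mX mN N0; exists (X @^-1` N); split => //.
  by rewrite -[X in measurable X]setTI; exact: mX.
by move=> w /= /contrapT.
Qed.

Lemma ae_forall_le (s : nat) (Q : nat -> Omega -> Prop) :
  (forall u, (u <= s)%N -> {ae P, forall w, Q u w}) ->
  {ae P, forall w, forall u, (u <= s)%N -> Q u w}.
Proof.
elim: s => [|s ih] h.
  by apply: filterS (h 0%N _) => // w Qw u; rewrite leqn0 => /eqP ->.
apply: filterS2 (ih (fun u us => h u (leqW us))) (h s.+1 _) => // w Qs Qs1 u.
by rewrite leq_eqVlt => /predU1P[->//|]; exact: Qs.
Qed.

Lemma ae_forall_fin (I : finType) (Q : I -> Omega -> Prop) :
  (forall i, {ae P, forall w, Q i w}) -> {ae P, forall w, forall i, Q i w}.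
Proof.
move=> h; suff : {ae P, forall w, forall i, i \in enum I -> Q i w}.
  by apply: filterS => w Qw i; apply: Qw; rewrite mem_enum.
elim: (enum I) => [|i s ih]; first exact: aeW.
apply: filterS2 ih (h i) => w Qs Qi j; rewrite inE => /predU1P[->//|].
exact: Qs.
Qed.

Lemma ae_eq_set_integral (C C' : set Omega) (f : Omega -> R) :
  measurable C -> measurable C' -> measurable_fun setT f ->
  {ae P, forall w, C w <-> C' w} ->
  (\int[P]_(w in C) (f w)%:E = \int[P]_(w in C') (f w)%:E)%E.
Proof.
move=> mC mC' mf CC'; rewrite integral_mkcond [RHS]integral_mkcond.
apply: ae_eq_integral => //.
- by apply/(measurable_restrictT _ mC); exact/measurable_EFinP/measurable_funTS.
- by apply/(measurable_restrictT _ mC'); exact/measurable_EFinP/measurable_funTS.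
- apply: filterS CC' => w CC' _; rewrite /patch; congr (if _ then _ else _).
  by apply/idP/idP; rewrite !inE => /CC'.
Qed.

Lemma ae_eq_set_measure (C C' : set Omega) :
  measurable C -> measurable C' -> {ae P, forall w, C w <-> C' w} -> P C = P C'.
Proof.
move=> mC mC' CC'; have := integral_cst P mC 1%E.
have := integral_cst P mC' 1%E; rewrite !mul1e => <- <-.
exact: (ae_eq_set_integral mC mC' (@measurable_cst _ _ Omega R setT 1) CC').
Qed.

Lemma mutually_independent2 (I : finType) d (T : measurableType d)
    (X : I -> Omega -> T) i j : mutually_independent P X -> i != j ->
  independent P (X i) (X j).
Proof.
move=> XI ij A B mA mB.
(* All other indices get the whole space and contribute factors 1. *)
pose S l := if l == i then A else if l == j then B else setT.
have mS l : measurable (S l) by rewrite /S; do 2 case: ifP => // _.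
have := XI S mS; rewrite (bigD1 i)//= (bigD1 j)/=; last by rewrite eq_sym.
rewrite big1 ?mule1; last first.
  by move=> l /andP[/negbTE li /negbTE lj]; rewrite /S li lj preimage_setT probability_setT.
rewrite /S !eqxx eq_sym (negbTE ij) => <-; congr (P _); apply/seteqP; split.
  move=> w [Aw Bw] l _ /=; case: eqP => [->//|_].
  by case: eqP => [->//|_].
move=> w h; split; first by have := h i Logic.I; rewrite /= eqxx.
by have := h j Logic.I; rewrite /= eqxx eq_sym (negbTE ij).
Qed.

(** The joint law is a product, and domination passes to products: almost every section of [N] is
    [m2]-null, hence null for the law of [Y], and the exceptional points form an [m1]-null set,
    hence a null set for the law of [X]. *)
Lemma independent_dominated d1 d2 (T1 : measurableType d1) (T2 : measurableType d2)
    (m1 : {sigma_finite_measure set T1 -> \bar R})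
    (m2 : {sigma_finite_measure set T2 -> \bar R})
    (X : Omega -> T1) (Y : Omega -> T2) (N : set (T1 * T2)) :
  measurable_fun setT X -> measurable_fun setT Y -> independent P X Y ->
  (forall M, measurable M -> m1 M = 0 -> P (X @^-1` M) = 0)%E ->
  (forall M, measurable M -> m2 M = 0 -> P (Y @^-1` M) = 0)%E ->
  measurable N -> (m1 \x m2)%E N = 0%E ->
  P ((fun w => (X w, Y w)) @^-1` N) = 0%E.
Proof.
move=> mX mY XY Xm1 Ym2 mN N0.
have := independent_law mX mY XY mN => ->; apply/product_null_ae => //.
have := Xm1 _ (measurable_xsection_neq0 m2 mN) (proj1 (product_null_ae m1 m2 mN) N0).
apply: subset_measure0 => //.
- rewrite -[X in measurable X]setTI; apply: mX => //.
  exact: measurable_xsection_neq0.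
- rewrite -[X in measurable X]setTI; apply: mX => //.
  exact: measurable_xsection_neq0.
- move=> w /=; apply: contra => /eqP m0; apply/eqP.
  exact: Ym2 (measurable_xsection _ mN) m0.
Qed.

End almost_sure.

Lemma g_sigma_algebra_preimage_sub disp (Omega : measurableType disp)
    (G : set (set Omega)) d (T : measurableType d) (X : Omega -> T) :
  subsigma G -> measurable_wrt G X -> g_sigma_algebra_preimage X `<=` G.
Proof. by move=> sG /(measurable_wrtP _ sG) mX _ [S mS <-]; rewrite setTI; exact: mX. Qed.

(** * Paths of states and edges *)

Section paths.
Context {R : realType} {d k : nat} {disp : measure_display}
  {Omega : measurableType disp} {P : probability Omega R}.
Local Notation V := 'rV[R]_d.
Variables (Z : 'I_k -> nat -> {RV P >-> V}) (A : 'I_k -> 'I_k -> nat -> {RV P >-> bool}).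

Lemma measurable_wrt_traj d' (T : measurableType d') (X : nat -> {RV P >-> T}) s
    (G : set (set Omega)) :
  (forall u, (u <= s)%N -> measurable_wrt G (X u)) -> measurable_wrt G (traj X s).
Proof.
move=> mX; apply/measurable_fun_tnthP => u.
rewrite (_ : _ \o _ = X u); first by apply: mX; rewrite -ltnS.
by apply/funext => w /=; rewrite tnth_mktuple.
Qed.

Lemma measurable_traj d' (T : measurableType d') (X : nat -> {RV P >-> T}) s :
  measurable_fun setT (traj X s).
Proof.
apply/measurable_fun_tnthP => u.
rewrite (_ : _ \o _ = X u)//.
by apply/funext => w /=; rewrite tnth_mktuple.
Qed.

Lemma trajE d' (T : measurableType d') (X : nat -> {RV P >-> T}) s w (u : 'I_s.+1) :
  tnth (traj X s w) u = X u w.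
Proof. by rewrite tnth_mktuple. Qed.

Lemma nth_traj (X : nat -> {RV P >-> V}) s u w : (u <= s)%N -> (traj X s w)`_u = X u w.
Proof.
move=> us; have us' : (u < s.+1)%N by [].
by rewrite -[u in LHS]/(val (Ordinal us')) -tnth_nth trajE.
Qed.

Lemma measurable_Zpath s : measurable_fun setT (Zpath Z s).
Proof.
apply/measurable_fun_tnthP => i; rewrite (_ : _ \o _ = traj (Z i) s).
  exact: measurable_traj.
by apply/funext => w /=; rewrite tnth_mktuple.
Qed.

Lemma measurable_Apath s : measurable_fun setT (Apath A s).
Proof.
apply/measurable_fun_tnthP => i; apply/measurable_fun_tnthP => j.
rewrite (_ : _ \o _ = traj (A i j) s).
  exact: measurable_traj.
by apply/funext => w /=; rewrite !tnth_mktuple.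
Qed.

Lemma subsigma_sigG s : subsigma (sigG Z s).
Proof. exact: subsigma_preimage (@measurable_Zpath s). Qed.

Lemma subsigma_sigF s : subsigma (sigF Z A s).
Proof.
exact: subsigma_preimage (measurable_fun_pair (@measurable_Zpath s) (@measurable_Apath s)).
Qed.

Lemma subsigma_sigGA s : subsigma (sigGA Z A s).
Proof.
case: s => [|s]; first exact: subsigma_sigG.
exact: subsigma_preimage (measurable_fun_pair (@measurable_Zpath _) (@measurable_Apath s)).
Qed.

Lemma measurable_wrt_Zpath s i u (G : set (set Omega)) : (u <= s)%N ->
  measurable_wrt G (Zpath Z s) -> measurable_wrt G (Z i u).
Proof.
move=> us mG; have us' : (u < s.+1)%N by [].
rewrite /measurable_wrt (_ : (Z i u : _ -> _) =
    (fun x => tnth (tnth x i) (Ordinal us')) \o Zpath Z s).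
  apply: measurableT_comp mG.
  apply: (measurableT_comp (measurable_tnth _) (measurable_tnth _)).
by apply/funext => w /=; rewrite !tnth_mktuple.
Qed.

Lemma measurable_wrt_Apath s i j u (G : set (set Omega)) : (u <= s)%N ->
  measurable_wrt G (Apath A s) -> measurable_wrt G (A i j u).
Proof.
move=> us mG; have us' : (u < s.+1)%N by [].
rewrite /measurable_wrt (_ : (A i j u : _ -> _) =
    (fun x => tnth (tnth (tnth x i) j) (Ordinal us')) \o Apath A s).
  apply: measurableT_comp mG.
  apply: (measurableT_comp (measurable_tnth _)
    (measurableT_comp (measurable_tnth _) (measurable_tnth _))).
by apply/funext => w /=; rewrite !tnth_mktuple.
Qed.

Lemma measurable_wrt_pair d1 d2 (T1 : measurableType d1) (T2 : measurableType d2)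
    (X : Omega -> T1) (Y : Omega -> T2) :
  let G := g_sigma_algebra_preimage (fun w => (X w, Y w)) in
  measurable_wrt G X /\ measurable_wrt G Y.
Proof.
move=> G; have mG : measurable_wrt G (fun w => (X w, Y w)).
  exact: measurable_wrt_preimage.
split; first exact: (measurableT_comp measurable_fst mG).
exact: (measurableT_comp measurable_snd mG).
Qed.

Lemma sigG_Z i u s : (u <= s)%N -> measurable_wrt (sigG Z s) (Z i u).
Proof. by move=> us; apply: measurable_wrt_Zpath us _; exact: measurable_wrt_preimage. Qed.

Lemma sigF_Z i u s : (u <= s)%N -> measurable_wrt (sigF Z A s) (Z i u).
Proof.
move=> us; apply: measurable_wrt_Zpath us _.
by have [] := measurable_wrt_pair (Zpath Z s) (Apath A s).
Qed.

Lemma sigF_A i j u s : (u <= s)%N -> measurable_wrt (sigF Z A s) (A i j u).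
Proof.
move=> us; apply: measurable_wrt_Apath us _.
by have [] := measurable_wrt_pair (Zpath Z s) (Apath A s).
Qed.

Lemma sigGA_Z i u s : (u <= s)%N -> measurable_wrt (sigGA Z A s) (Z i u).
Proof.
case: s => [|s] us; first exact: sigG_Z.
apply: measurable_wrt_Zpath us _.
by have [] := measurable_wrt_pair (Zpath Z s.+1) (Apath A s).
Qed.

Lemma sigGA_A i j u s : (u < s)%N -> measurable_wrt (sigGA Z A s) (A i j u).
Proof.
case: s => [//|s] us; apply: measurable_wrt_Apath (us : (u <= s)%N) _.
by have [] := measurable_wrt_pair (Zpath Z s.+1) (Apath A s).
Qed.

Lemma Zpath_measurable_wrt s (G : set (set Omega)) :
  (forall i u, (u <= s)%N -> measurable_wrt G (Z i u)) -> measurable_wrt G (Zpath Z s).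
Proof.
move=> mZ; apply/measurable_fun_tnthP => i; rewrite (_ : _ \o _ = traj (Z i) s).
  by apply: measurable_wrt_traj => u; exact: mZ.
by apply/funext => w /=; rewrite tnth_mktuple.
Qed.

Lemma sigG_sub s (G : set (set Omega)) : subsigma G ->
  (forall i u, (u <= s)%N -> measurable_wrt G (Z i u)) -> sigG Z s `<=` G.
Proof.
move=> sG mZ; apply: g_sigma_algebra_preimage_sub => //.
exact: Zpath_measurable_wrt.
Qed.

Lemma sigG_mono s r : (s <= r)%N -> sigG Z s `<=` sigG Z r.
Proof.
move=> sr; apply: sigG_sub; first exact: subsigma_sigG.
by move=> i u us; apply: sigG_Z; exact: leq_trans sr.
Qed.

Lemma sigG_sigF s : sigG Z s `<=` sigF Z A s.
Proof. by apply: sigG_sub; [exact: subsigma_sigF|move=> i u us; exact: sigF_Z]. Qed.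

Lemma sigG_sigGA s : sigG Z s `<=` sigGA Z A s.
Proof. by apply: sigG_sub; [exact: subsigma_sigGA|move=> i u us; exact: sigGA_Z]. Qed.

(* An edge path is coded by a function on nat of which only the values up to the
   time s at hand matter. *)
Definition path_event (i j : 'I_k) (s : nat) (a : nat -> bool) : set Omega :=
  [set w | forall u, (u <= s)%N -> A i j u w = a u].

Lemma path_eventS i j s a :
  path_event i j s.+1 a = path_event i j s a `&` A i j s.+1 @^-1` [set a s.+1].
Proof.
apply/seteqP; split => [w h|w [h1 h2] u].
  by split; [move=> u us; apply: h; exact: leqW|exact: h].
by rewrite leq_eqVlt => /predU1P[->//|]; exact: h1.
Qed.

Lemma path_event0 i j a : path_event i j 0 a = A i j 0 @^-1` [set a 0].
Proof.
by apply/seteqP; split => [w h|w h u]; [exact: h|rewrite leqn0 => /eqP ->].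
Qed.

Lemma path_event_wrt i j s a (G : set (set Omega)) : subsigma G ->
  (forall u, (u <= s)%N -> measurable_wrt G (A i j u)) -> G (path_event i j s a).
Proof.
move=> sG; elim: s => [|s ih] mA.
  by rewrite path_event0; apply: (proj1 (measurable_wrtP _ sG)) => //; exact: mA.
rewrite path_eventS; apply: (subsigmaI sG).
  by apply: ih => u us; apply: mA; exact: leqW.
by apply: (proj1 (measurable_wrtP _ sG)) => //; exact: mA.
Qed.

Lemma measurable_path_event i j s a : measurable (path_event i j s a).
Proof.
elim: s => [|s ih].
  by rewrite path_event0 -[X in measurable X]setTI; exact: measurable_funP.
rewrite path_eventS; apply: measurableI => //.
by rewrite -[X in measurable X]setTI; exact: measurable_funP.
Qed.

End paths.

(** * Path weights and path events *)

Section path_weights.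
Context {R : realType} {d k : nat}.
Local Notation V := 'rV[R]_d.

Definition bernoulli_weight (p : R) (b : bool) : R := if b then p else 1 - p.

Lemma bernoulli_weight_ge0 p b : 0 <= p <= 1 -> 0 <= bernoulli_weight p b.
Proof. by case: b => /andP[p0 p1] //=; rewrite subr_ge0. Qed.

Lemma measurable_bernoulli_weight d' (T : measurableType d') (f : T -> R) b :
  measurable_fun setT f -> measurable_fun setT (fun x => bernoulli_weight (f x) b).
Proof. by case: b => mf //=; exact: measurable_funB. Qed.

Variables (B : bool -> V -> V -> R) (B0 : V -> V -> R).

(** The states [z] are deterministic, so that the same formula serves on [Omega], in [path_prob],
    and on path space, in [joint_weight]. *)
Fixpoint path_weight (z : 'I_k -> nat -> V) (i j : 'I_k) (s : nat) (a : nat -> bool) : R :=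
  if s is u.+1 then
    path_weight z i j u a * bernoulli_weight (B (a u) (z i s) (z j s)) (a s)
  else bernoulli_weight (B0 (z i 0) (z j 0)) (a 0).

Lemma eq_path_weight z z' i j s a a' :
  (forall l u, (u <= s)%N -> z l u = z' l u) -> (forall u, (u <= s)%N -> a u = a' u) ->
  path_weight z i j s a = path_weight z' i j s a'.
Proof.
elim: s => [|s ih] hz ha /=; first by rewrite !hz// ha.
rewrite !hz// !ha// ih// => [l u us|u us]; [exact/hz/leqW|exact/ha/leqW].
Qed.

Hypothesis mB : forall a, measurable_fun setT (fun z : V * V => B a z.1 z.2).
Hypothesis mB0 : measurable_fun setT (fun z : V * V => B0 z.1 z.2).
Hypothesis B01 : forall a x y, 0 <= B a x y <= 1.
Hypothesis B001 : forall x y, 0 <= B0 x y <= 1.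

Lemma path_weight_ge0 z i j s a : 0 <= path_weight z i j s a.
Proof.
elim: s => [|s ih] /=; first exact: bernoulli_weight_ge0.
by rewrite mulr_ge0// bernoulli_weight_ge0.
Qed.

Lemma measurable_path_weight d' (T : measurableType d') (z : T -> 'I_k -> nat -> V) i j s a :
  (forall l u, (u <= s)%N -> measurable_fun setT (fun x => z x l u)) ->
  measurable_fun setT (fun x => path_weight (z x) i j s a).
Proof.
elim: s => [|s ih] mz /=.
  apply: measurable_bernoulli_weight.
  exact: (measurableT_comp mB0 (measurable_fun_pair (mz i 0 _) (mz j 0 _))).
apply: measurable_funM; first by apply: ih => l u us; apply: mz; exact: leqW.
apply: measurable_bernoulli_weight.
exact: (measurableT_comp (mB (a s)) (measurable_fun_pair (mz i s.+1 _) (mz j s.+1 _))).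
Qed.

End path_weights.

Section cprob_complement.
Context {R : realType} {disp : measure_display} {Omega : measurableType disp}.
Variable P : probability Omega R.

Lemma cprob_setC (G : set (set Omega)) E f : subsigma G -> measurable E ->
  cprob P G E f -> (forall w, f w <= 1) -> cprob P G (~` E) (fun w => 1 - f w).
Proof.
move=> sG mE [mf f0 fE] f1; split.
- exact: measurable_funB.
- by move=> w; rewrite subr_ge0.
move=> C GC; have mC : measurable C by exact: sG.2.
have mfC : measurable_fun C f by apply: measurable_funTS; exact: measurable_wrtW mf.
have fin : P (E `&` C) \is a fin_num by rewrite fin_num_measure//; exact: measurableI.
(* The finite probability of [E] within [C] is added to both sides, which then both equal [P C]. *)
rewrite -[LHS](addeK _ fin) -[RHS](addeK _ fin).
congr (_ - _)%E; rewrite -measureU//; last 3 first.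
- by apply: measurableI => //; exact: measurableC.
- exact: measurableI.
- by rewrite setIACA setICl set0I.
rewrite -setIUl setUC setUv setTI fE// -ge0_integralD//.
- under eq_integral do rewrite -EFinD subrK.
  by have := integral_cst P mC 1%E; rewrite mul1e.
- by move=> w _; rewrite lee_fin subr_ge0.
- by apply/measurable_EFinP; exact: measurable_funB.
- by move=> w _; rewrite lee_fin.
- exact/measurable_EFinP.
Qed.

End cprob_complement.

Section finite_events.
Context {disp : measure_display} {Omega : measurableType disp}.

Lemma subsigma_bigcap_fin (G : set (set Omega)) (I : finType) (F : I -> set Omega) :
  subsigma G -> (forall i, G (F i)) -> G (\bigcap_i F i).
Proof.
move=> sG GF; have := @fin_bigcap_measurable _ (g_sigma_algebraType G) I setT F
  finite_finset (fun i _ => @sub_sigma_algebra _ setT G _ (GF i)).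
by rewrite -[X in X _]/(<<s G >>) sigma_algebra_id//; exact: sG.1.
Qed.

Lemma measurable_bool_tuple n (S : set (n.-tuple bool)) : measurable S.
Proof.
apply: countable_measurable; last exact: countableP.
move=> x; rewrite (_ : [set x] =
    \bigcap_(i in [set: 'I_n]) ((@tnth _ _)^~ i) @^-1` [set tnth x i]).
  apply: fin_bigcap_measurable => // i _; rewrite -[X in measurable X]setTI.
  exact: measurable_tnth.
apply/seteqP; split => [y -> //|y h].
by apply: eq_from_tnth => i; exact: h.
Qed.

End finite_events.

Section path_events.
Context {R : realType} {k : nat} {disp : measure_display}
  {Omega : measurableType disp} {P : probability Omega R}.
Variable A : 'I_k -> 'I_k -> nat -> {RV P >-> bool}.

(** The default [false] is only reached after time [s], where [path_event] does not look; a tuple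
    therefore codes exactly one path event. *)
Lemma path_event_nth i j s (x : s.+1.-tuple bool) w :
  path_event A i j s (nth false x) w <-> traj (A i j) s w = x.
Proof.
split=> [h|<- u us].
  apply: eq_from_tnth => u; rewrite trajE (h u); last by rewrite -ltnS.
  by rewrite -tnth_nth.
have us' : (u < s.+1)%N by [].
by rewrite -[u in RHS]/(val (Ordinal us')) -tnth_nth trajE.
Qed.

Lemma traj_preimage_bigcup i j s (S : set (s.+1.-tuple bool)) :
  traj (A i j) s @^-1` S =
  \bigcup_(x in [set` [pred x | x \in S]]) path_event A i j s (nth false x).
Proof.
apply/seteqP; split => [w Sw|w [x /= xS /path_event_nth xw]].
  by exists (traj (A i j) s w); [exact: mem_set|exact/path_event_nth].
by rewrite /preimage/= xw; exact: (set_mem xS).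
Qed.

Lemma trivIset_path_event i j s :
  trivIset setT (fun x : s.+1.-tuple bool => path_event A i j s (nth false x)).
Proof.
apply/trivIsetP => x y _ _ /eqP xy; apply/seteqP; split => // w [].
by move=> /path_event_nth xw /path_event_nth yw; apply: xy; rewrite -xw -yw.
Qed.

Local Notation Ae e := (A (val e).1 (val e).2).

Definition edge_path_event s (a : edge k -> nat -> bool) : set Omega :=
  \bigcap_(e in [set: edge k]) path_event A (val e).1 (val e).2 s (a e).

Lemma measurable_edge_path_event s a : measurable (edge_path_event s a).
Proof.
apply: fin_bigcap_measurable => [|e _]; first exact: finite_finset.
exact: measurable_path_event.
Qed.

Lemma trivIset_edge_path_event s : trivIset setT
  (fun x : {ffun edge k -> s.+1.-tuple bool} => edge_path_event s (fun e => nth false (x e))).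
Proof.
apply/trivIsetP => x y _ _ /eqP xy; apply/seteqP; split => // w [xw yw]; apply: xy.
apply/ffunP => e.
have /path_event_nth xe := xw e Logic.I.
by have /path_event_nth ye := yw e Logic.I; rewrite -xe -ye.
Qed.

Lemma edge_path_event_cover s w : exists x : {ffun edge k -> s.+1.-tuple bool},
  edge_path_event s (fun e => nth false (x e)) w.
Proof.
exists [ffun e => traj (Ae e) s w] => e _.
by rewrite ffunE; apply/path_event_nth.
Qed.

Lemma edge_traj_preimage_bigcup s (S : edge k -> set (s.+1.-tuple bool)) :
  \bigcap_(e in [set: edge k]) (traj (Ae e) s @^-1` S e) =
  \bigcup_(x in [set` family (fun e => [pred x | x \in S e])])
    edge_path_event s (fun e => nth false ((x : {ffun edge k -> s.+1.-tuple bool}) e)).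
Proof.
apply/seteqP; split => [w Sw|w [x /= xS xw] e _].
  exists [ffun e => traj (Ae e) s w].
    by apply/familyP => e; rewrite ffunE; apply: mem_set; exact: Sw.
  by move=> e _; rewrite ffunE; apply/path_event_nth.
have /path_event_nth E := xw e Logic.I; rewrite /= E.
by apply: set_mem; move/familyP : xS => /(_ e).
Qed.

Lemma edge_path_eventS s a : edge_path_event s.+1 a =
  edge_path_event s a `&` \bigcap_(e in [set: edge k]) (Ae e s.+1 @^-1` [set a e s.+1]).
Proof.
rewrite -bigcapI; apply: eq_bigcapr => e _; exact: path_eventS.
Qed.

Lemma edge_path_event0 a :
  edge_path_event 0 a = \bigcap_(e in [set: edge k]) (Ae e 0 @^-1` [set a e 0]).
Proof. by apply: eq_bigcapr => e _; exact: path_event0. Qed.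

End path_events.

(** Versions are almost surely unique, so the unspecified [q] of a conditional independence may be
    exchanged for the explicit [f], at the price of finitely many null sets. *)
Lemma cond_prob_is_prod (R : realType) disp (Omega : measurableType disp)
    (P : probability Omega R) (G : set (set Omega)) (I : finType)
    (E : I -> set Omega) (D : set Omega) (q f : I -> Omega -> R) :
  subsigma G -> measurable D -> (forall i, measurable (E i)) ->
  (forall i, cond_prob_version P G (E i) (q i)) ->
  cond_prob_is P G D (fun w => \prod_i q i w) ->
  (forall i, cprob P G (E i) (f i)) ->
  cprob P G D (fun w => \prod_i f i w).
Proof.
move=> sG mD mE qv qD Ef; apply: (cond_prob_is_cprob sG mD qD).
- by apply: (@measurable_prod _ (g_sigma_algebraType G)) => i _; have [] := Ef i.
- by move=> w; apply: prodr_ge0 => i _; exact: cprob_ge0 (Ef i) w.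
- have := ae_forall_fin (fun i => cond_exp_version_unique sG (qv i)
    (cprob_version sG (mE i) (Ef i))).
  by apply: filterS => w qf; apply: eq_bigr => i _; exact: qf.
Qed.

(** * Testing on a finite partition *)

Section finite_partition.
Context {R : realType} {disp : measure_display} {Omega : measurableType disp}.
Variable P : probability Omega R.
Variables (I : finType) (F : I -> set Omega).
Hypothesis mF : forall i, measurable (F i).
Hypothesis tF : trivIset setT F.
Hypothesis cF : forall w, exists i, F i w.

Lemma measure_partition C : measurable C -> (P C = \sum_i P (F i `&` C))%E.
Proof.
move=> mC; rewrite -(measure_bigcup_finType P xpredT); last 2 first.
- by move=> i; exact: measurableI.
- apply/trivIsetP => i j _ _ ij; rewrite setIACA setIid.
  by move/trivIsetP : tF => /(_ _ _ Logic.I Logic.I ij) ->; rewrite set0I.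
congr (P _); apply/seteqP; split => [w Cw|w [i _ []]//].
by have [i Fi] := cF w; exists i.
Qed.

Lemma integral_partition C (f : Omega -> R) : measurable C ->
  measurable_fun setT f -> (forall w, 0 <= f w) ->
  (\int[P]_(w in C) (f w)%:E = \sum_i \int[P]_(w in F i `&` C) (f w)%:E)%E.
Proof.
move=> mC mf f0.
transitivity (\int[P]_(w in C) (\sum_i ((fun w => (f w)%:E) \_ (F i)) w))%E.
  apply: eq_integral => w _; have [i Fi] := cF w.
  rewrite (bigD1 i)//= big1 ?adde0 ?patchT ?inE// => j ji.
  rewrite patchN//; apply/negP; rewrite inE => Fj.
  have : (F j `&` F i) w by split.
  by move/trivIsetP : tF => /(_ _ _ Logic.I Logic.I ji) ->.
rewrite ge0_integral_sum//.
- by apply: eq_bigr => i _; rewrite integral_mkcondl.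
- move=> i; apply/(measurable_restrict _ (mF i) mC).
  exact/measurable_EFinP/measurable_funTS.
- by move=> i w _; rewrite /patch; case: ifP => // _; rewrite lee_fin.
Qed.

(* The events F i determine Y up to a null set; it is then enough to test on
   the traces of the events of X on the F i. *)
Lemma cprob_pair_partition d1 d2 (T1 : measurableType d1) (T2 : measurableType d2)
    (X : Omega -> T1) (Y : Omega -> T2) (y : I -> T2) E (f : Omega -> R) :
  let G := g_sigma_algebra_preimage (fun w => (X w, Y w)) in
  measurable_fun setT X -> measurable_fun setT Y -> measurable E ->
  {ae P, forall w i, F i w -> Y w = y i} ->
  measurable_wrt G f -> (forall w, 0 <= f w) ->
  (forall i S, measurable S -> P (E `&` (F i `&` X @^-1` S)) =
    \int[P]_(w in F i `&` X @^-1` S) (f w)%:E)%E ->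
  cprob P G E f.
Proof.
move=> G mX mY mE Fy mf f0 EI; split => // _ [U mU <-]; rewrite setTI.
have sG : subsigma G := subsigma_preimage (measurable_fun_pair mX mY).
have mC : measurable ((fun w => (X w, Y w)) @^-1` U).
  by apply: sG.2; exists U => //; rewrite setTI.
have mfT := measurable_wrtW sG mf.
rewrite (integral_partition mC mfT f0) (measure_partition (measurableI _ _ mE mC)).
apply: eq_bigr => i _.
(* On [F i] the second component is almost surely [y i], so that [U] reduces to its section there,
   an event of [X] alone. *)
pose S := (fun x => (x, y i)) @^-1` U.
have mS : measurable S.
  by rewrite -[X in measurable X]setTI; exact: pair2_measurable.
have mXS : measurable (X @^-1` S) by rewrite -[X in measurable X]setTI; exact: mX.
have FS : {ae P, forall w, (F i `&` (fun w => (X w, Y w)) @^-1` U) w <->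
    (F i `&` X @^-1` S) w}.
  apply: filterS Fy => w Fy; rewrite /S /=.
  by split => -[Fi]; rewrite (Fy _ Fi).
rewrite (ae_eq_set_integral _ _ mfT FS); [|exact: measurableI|exact: measurableI].
rewrite -EI//; apply: ae_eq_set_measure.
- by apply: measurableI => //; exact: measurableI.
- by apply: measurableI => //; exact: measurableI.
- apply: filterS FS => w FS; split.
    by move=> [Fi [Ew Cw]]; split => //; apply/FS.
  by move=> [Ew /FS[Fi Cw]].
Qed.

End finite_partition.

Section sigma_joins.
Context {R : realType} {disp : measure_display} {Omega : measurableType disp}.

Lemma sigma_join_preimage d1 d2 (T1 : measurableType d1) (T2 : measurableType d2)
    (X : Omega -> T1) (Y : Omega -> T2) :
  sigma_join (g_sigma_algebra_preimage X) (g_sigma_algebra_preimage Y) =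
  g_sigma_algebra_preimage (fun w => (X w, Y w)).
Proof. exact: (g_sigma_preimageU_comp fst snd (fun w => (X w, Y w))). Qed.

Lemma mutually_cond_independent_comp (P : probability Omega R) (I : finType)
    d1 d2 (T1 : measurableType d1) (T2 : measurableType d2)
    (G : set (set Omega)) (X : I -> Omega -> T1) (h : T1 -> T2) :
  measurable_fun setT h -> mutually_cond_independent P G X ->
  mutually_cond_independent P G (fun i => h \o X i).
Proof.
move=> mh Xci S mS; apply: (Xci (fun i => h @^-1` S i)) => i.
by rewrite -[X in measurable X]setTI; exact: mh.
Qed.

End sigma_joins.

(** * Dynamics and conditional structures *)

Section transition_map.
Context {R : realType} {d k : nat}.
Local Notation V := 'rV[R]_d.
Variables (gamma : R) (B : bool -> V -> V -> R) (B0 : V -> V -> R).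

Definition next_mean s (mu : probability (s.+1.-tuple V) R) (x : s.+1.-tuple V) : V :=
  (1 - gamma) *: x`_s + gamma *: drift B B0 mu x.

(** Returns the whole path and not only the new state, because the preimages of the path are the
    events of [sigG] at the next time. The law [mu] is a parameter: once it is fixed, the recursion
    is a Borel map of path and noise. *)
Definition next_Zpath s (mu : probability (s.+1.-tuple V) R)
    (p : k.-tuple (s.+1.-tuple V) * k.-tuple V) : k.-tuple (s.+2.-tuple V) :=
  [tuple [tuple if (u <= s)%N then (tnth p.1 i)`_u
                else next_mean mu (tnth p.1 i) + tnth p.2 i | u < s.+2] | i < k].

Hypothesis mB : forall a, measurable_fun setT (fun z : V * V => B a z.1 z.2).
Hypothesis mB0 : measurable_fun setT (fun z : V * V => B0 z.1 z.2).
Hypothesis B01 : forall a x y, 0 <= B a x y <= 1.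
Hypothesis B001 : forall x y, 0 <= B0 x y <= 1.

Lemma measurable_rV_add d' (T : measurableType d') (f g : T -> V) :
  measurable_fun setT f -> measurable_fun setT g ->
  measurable_fun setT (fun x => f x + g x).
Proof.
move=> mf mg; apply: measurable_fun_rVP => j; under eq_fun do rewrite mxE.
apply: measurable_funD.
  exact: (measurableT_comp (measurable_rV_coord j) mf).
exact: (measurableT_comp (measurable_rV_coord j) mg).
Qed.

Lemma measurable_rV_scale d' (T : measurableType d') (a : R) (f : T -> V) :
  measurable_fun setT f -> measurable_fun setT (fun x => a *: f x).
Proof.
move=> mf; apply: measurable_fun_rVP => j; under eq_fun do rewrite mxE.
apply: measurable_funM => //.
exact: (measurableT_comp (measurable_rV_coord j) mf).
Qed.

Lemma measurable_next_mean s (mu : probability (s.+1.-tuple V) R) :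
  measurable_fun setT (next_mean mu).
Proof.
apply: measurable_rV_add; apply: measurable_rV_scale.
  exact: measurable_tuple_nth.
exact: measurable_drift.
Qed.

Lemma measurable_next_Zpath s (mu : probability (s.+1.-tuple V) R) :
  measurable_fun setT (next_Zpath mu).
Proof.
apply/measurable_fun_tnthP => i; apply/measurable_fun_tnthP => u.
have m1 : measurable_fun setT (fun p : k.-tuple (s.+1.-tuple V) * k.-tuple V => tnth p.1 i).
  exact: (measurableT_comp (measurable_tnth i) measurable_fst).
have m2 : measurable_fun setT (fun p : k.-tuple (s.+1.-tuple V) * k.-tuple V => tnth p.2 i).
  exact: (measurableT_comp (measurable_tnth i) measurable_snd).
rewrite (_ : _ \o _ = fun p : k.-tuple (s.+1.-tuple V) * k.-tuple V =>
    if (u <= s)%N then (tnth p.1 i)`_u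
    else next_mean mu (tnth p.1 i) + tnth p.2 i); last first.
  by apply/funext => p /=; rewrite !tnth_mktuple.
case: (boolP (u <= s)%N) => _.
  exact: (measurableT_comp (@measurable_tuple_nth _ _ _ u) m1).
apply: measurable_rV_add => //.
exact: (measurableT_comp (@measurable_next_mean _ mu) m1).
Qed.

End transition_map.

Section dynamics.
Context {R : realType} {d k t : nat}.
Local Notation V := 'rV[R]_d.
Variables (gamma : R) (B B' : bool -> V -> V -> R) (B0 B0' : V -> V -> R)
  (N : set (V * V)) (mu0 noise : probability V R).
Hypothesis mB : forall a, measurable_fun setT (fun z : V * V => B' a z.1 z.2).
Hypothesis mB0 : measurable_fun setT (fun z : V * V => B0' z.1 z.2).
Hypothesis B01 : forall a x y, 0 <= B' a x y <= 1.
Hypothesis B001 : forall x y, 0 <= B0' x y <= 1.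
Hypothesis mN : measurable N.
Hypothesis N0 : (lebesgue_rV R d \x lebesgue_rV R d)%E N = 0%E.
Hypothesis BE : forall a x y, ~ N (x, y) -> B a x y = B' a x y.
Hypothesis B0E : forall x y, ~ N (x, y) -> B0 x y = B0' x y.
Hypothesis mu0_ac : mu0 `<< lebesgue_rV R d.
Hypothesis noise_ac : noise `<< lebesgue_rV R d.

Context {disp : measure_display} {Omega : measurableType disp} {P : probability Omega R}.
Variables (Z : 'I_k -> nat -> {RV P >-> V}) (A : 'I_k -> 'I_k -> nat -> {RV P >-> bool})
  (i1 : 'I_k).
Hypothesis HC : common_requirements gamma B B0 mu0 noise t Z A i1.

Definition traj_law s : probability (s.+1.-tuple V) R :=
  distribution P (rv_of P (measurable_traj (Z i1) (s := s))).

Let mZ i s : measurable_fun setT (Z i s) := measurable_funPT (Z i s).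

(** Absolute continuity up to time [s] is a premise here, in [drift_ae] and in [Z_next_of_null],
    since its proof in [Z_null] is an induction that goes through them. *)
Lemma null_Z_section s : (forall u, (u <= s)%N -> forall M, measurable M ->
    lebesgue_rV R d M = 0%E -> forall i, P (Z i u @^-1` M) = 0%E) ->
  forall i, {ae P, forall w, forall u, (u <= s)%N ->
    lebesgue_rV R d (xsection N (Z i u w)) = 0%E}.
Proof.
move=> ac i; apply: ae_forall_le => u us.
have mS := measurable_xsection_neq0 (lebesgue_rV R d) mN.
have S0 := proj1 (product_null_ae (lebesgue_rV R d) (lebesgue_rV R d) mN) N0.
have := ae_notin_null (mZ i u) mS (ac u us _ mS S0 i).
by apply: filterS => w /= /negP; rewrite negbK => /eqP.
Qed.

(** For almost every [w] the sections of [N] at the states [Z i u w] are Lebesgue null; the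
    integration variable is distributed as the path of [Z i1], whose states are absolutely
    continuous, so almost every [z] avoids these sections. This covers [i = i1] too, as [w] is
    frozen while [z] varies. *)
Lemma drift_ae s : (forall u, (u <= s)%N -> forall M, measurable M ->
    lebesgue_rV R d M = 0%E -> forall i, P (Z i u @^-1` M) = 0%E) ->
  forall i, {ae P, forall w, drift B B0 (pushforward P (traj (Z i1) s)) (traj (Z i) s w)
    = drift B' B0' (traj_law s) (traj (Z i) s w)}.
Proof.
move=> ac i; apply: filterS (null_Z_section ac i) => w sec0.
have [M [mM M0 sM]] : {ae traj_law s, forall z : s.+1.-tuple V, forall u, (u <= s)%N ->
    ~ xsection N (Z i u w) z`_u}.
  apply: ae_forall_le => u us; apply: ae_notin_null.
  - exact: measurable_tuple_nth.
  - exact: measurable_xsection.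
  - have := ac u us _ (measurable_xsection (Z i u w) mN) (sec0 u us) i1.
    by congr (P _ = _); apply/seteqP; split => v /=; rewrite nth_traj.
apply: (@eq_drift _ _ _ _ _ _ _ BE B0E s (traj_law s) _ M mM M0) => z Mz u us.
rewrite nth_traj// => Nz; apply: Mz; apply: sM => /(_ u us); apply.
by rewrite xsectionE.
Qed.

Let xi_spec xi := [/\ Z_dynamics gamma B B0 t Z i1 xi,
  mutually_independent P (@noise_family R d k t _ _ P xi),
  forall i s S, (s < t)%N -> measurable S -> P (xi i s @^-1` S) = noise S &
  forall s, (s < t)%N -> independent_of P (noise_vector xi s) (sigF Z A s)].

Lemma measurable_noise_vector xi s : measurable_fun setT (@noise_vector R d k _ _ P xi s).
Proof.
apply/measurable_fun_tnthP => i; rewrite (_ : _ \o _ = xi i s)//.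
by apply/funext => w /=; rewrite tnth_mktuple.
Qed.

Lemma noise_vector_independent xi s d' (T : measurableType d') (X : Omega -> T) :
  xi_spec xi -> (s < t)%N -> measurable_wrt (sigF Z A s) X ->
  independent P X (noise_vector xi s).
Proof.
move=> [_ _ _ ind] st /(measurable_wrtP _ (subsigma_sigF Z A s)) mX C D mC mD.
by rewrite setIC ind//; [rewrite muleC|exact: mX].
Qed.

Lemma noise_null xi i s M : xi_spec xi -> (s < t)%N -> measurable M ->
  lebesgue_rV R d M = 0%E -> P (xi i s @^-1` M) = 0%E.
Proof.
move=> [_ _ law _] st mM M0; rewrite law//.
by move/null_content_dominatesP : noise_ac; apply.
Qed.

Definition Z_mean i s w : V := next_mean gamma B' B0' (traj_law s) (traj (Z i) s w).

Lemma measurable_Z_mean i s (G : set (set Omega)) :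
  (forall u, (u <= s)%N -> measurable_wrt G (Z i u)) -> measurable_wrt G (Z_mean i s).
Proof.
move=> mG; apply: (@measurableT_comp _ _ _ _ _ _ (next_mean gamma B' B0' (traj_law s))).
  exact: measurable_next_mean.
exact: measurable_wrt_traj.
Qed.

Lemma Z_next_of_null xi s : xi_spec xi -> (s < t)%N ->
  (forall u, (u <= s)%N -> forall M, measurable M ->
    lebesgue_rV R d M = 0%E -> forall i, P (Z i u @^-1` M) = 0%E) ->
  forall i, {ae P, forall w, Z i s.+1 w = Z_mean i s w + xi i s w}.
Proof.
move=> [dyn _ _ _] st ac i; apply: filterS2 (dyn i s st) (drift_ae ac i) => w [_ ->] ->.
by rewrite /Z_mean /next_mean nth_traj.
Qed.

(** With absolute continuity known before, the recursion holds with Borel kernels. Freezing the mean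
    at [x], the new state is the noise translated by [x], and translations preserve Lebesgue null
    sets. *)
Lemma Z_null s : (s <= t)%N -> forall M, measurable M ->
  lebesgue_rV R d M = 0%E -> forall i, P (Z i s @^-1` M) = 0%E.
Proof.
have [xi xiP] := Z_solves HC.
elim/ltn_ind: s => -[|s] ih st M mM M0 i.
  by rewrite (Z0_law HC)//; move/null_content_dominatesP : mu0_ac; apply.
have {}ih u : (u <= s)%N -> forall M, measurable M ->
    lebesgue_rV R d M = 0%E -> forall i, P (Z i u @^-1` M) = 0%E.
  by move=> us; apply: ih => //; rewrite (leq_trans us)// ltnW.
have mZm : measurable_wrt (sigF Z A s) (Z_mean i s).
  by apply: measurable_Z_mean => u us; exact: sigF_Z.
have mZmT := measurable_wrtW (subsigma_sigF Z A s) mZm.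
have mg : measurable_fun setT (fun p : V * k.-tuple V => p.1 + tnth p.2 i).
  apply: measurable_rV_add => //.
  exact: (measurableT_comp (measurable_tnth i) measurable_snd).
have := independent_null mZmT (@measurable_noise_vector xi s)
  (noise_vector_independent xiP st mZm) mg mM.
move=> <-.
  apply: ae_eq_set_measure.
  - by rewrite -[X in measurable X]setTI; exact: mZ.
  - rewrite -[X in measurable X]setTI.
    exact: (measurableT_comp mg (measurable_fun_pair mZmT (@measurable_noise_vector xi s))).
  - apply: filterS (Z_next_of_null xiP st ih i) => w /= ->.
    by rewrite tnth_mktuple.
move=> x; have [mt tN] := lebesgue_rV_translate x.
have mxM : measurable ((fun y => x + y) @^-1` M).
  by rewrite -[X in measurable X]setTI; exact: mt.
rewrite -[RHS](noise_null i xiP st mxM (tN _ mM M0)).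
by congr (P _); apply/seteqP; split => w /=; rewrite tnth_mktuple.
Qed.

Lemma Z_next xi s i : xi_spec xi -> (s < t)%N ->
  {ae P, forall w, Z i s.+1 w = Z_mean i s w + xi i s w}.
Proof.
move=> xiP st; apply: (Z_next_of_null xiP st) => u us.
by apply: Z_null; rewrite (leq_trans us)// ltnW.
Qed.

(** The two means may be dependent, and are frozen together as one function of the past. What
    remains is a translate of a pair of independent noises, each of them absolutely continuous. *)
Lemma Z_pair_null s i j M : (s <= t)%N -> i != j -> measurable M ->
  (lebesgue_rV R d \x lebesgue_rV R d)%E M = 0%E ->
  P ((fun w => (Z i s w, Z j s w)) @^-1` M) = 0%E.
Proof.
move=> + ij mM M0; case: s => [_|s st].
  apply: (independent_dominated (mZ i 0) (mZ j 0) _ _ _ mM M0).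
  - exact: (mutually_independent2 (Z0_independent HC)).
  - by move=> S mS S0; exact: Z_null.
  - by move=> S mS S0; exact: Z_null.
have [xi xiP] := Z_solves HC.
have mX : measurable_wrt (sigF Z A s) (fun w => (Z_mean i s w, Z_mean j s w)).
  by apply: measurable_fun_pair; apply: measurable_Z_mean => u us; exact: sigF_Z.
have mXT := measurable_wrtW (subsigma_sigF Z A s) mX.
have mg : measurable_fun setT (fun p : (V * V) * k.-tuple V =>
    (p.1.1 + tnth p.2 i, p.1.2 + tnth p.2 j)).
  apply: measurable_fun_pair; apply: measurable_rV_add.
  - exact: (measurableT_comp measurable_fst measurable_fst).
  - exact: (measurableT_comp (measurable_tnth i) measurable_snd).
  - exact: (measurableT_comp measurable_snd measurable_fst).
  - exact: (measurableT_comp (measurable_tnth j) measurable_snd).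
have := independent_null mXT (@measurable_noise_vector xi s)
  (noise_vector_independent xiP st mX) mg mM.
move=> <-.
  apply: ae_eq_set_measure.
  - rewrite -[X in measurable X]setTI; apply: measurable_fun_pair => //; exact: mZ.
  - rewrite -[X in measurable X]setTI.
    exact: (measurableT_comp mg (measurable_fun_pair mXT (@measurable_noise_vector xi s))).
  - apply: filterS2 (Z_next i xiP st) (Z_next j xiP st) => w /= -> ->.
    by rewrite !tnth_mktuple.
move=> [x y]; have [mt tN] := null_preserving_pair
  (lebesgue_rV_translate x) (lebesgue_rV_translate y).
have mxM : measurable ((fun z : V * V => (x + z.1, y + z.2)) @^-1` M).
  by rewrite -[X in measurable X]setTI; exact: mt.
(* The noises are independent as a family over particles and times; [p] selects the entries at time
   [s]. *)
have [_ fam _ _] := xiP; pose p i : 'I_k * 'I_t := (i, Ordinal st).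
have ind : independent P (xi i s) (xi j s).
  apply: (mutually_independent2 (i := p i) (j := p j) fam).
  by rewrite /p xpair_eqE negb_and ij.
have := independent_dominated (m1 := lebesgue_rV R d) (m2 := lebesgue_rV R d)
  (measurable_funPT (xi i s)) (measurable_funPT (xi j s)) ind _ _ mxM (tN _ mM M0).
move=> <-.
- by congr (P _); apply/seteqP; split => w /=; rewrite !tnth_mktuple.
- by move=> S mS S0; exact: noise_null _ xiP st mS S0.
- by move=> S mS S0; exact: noise_null _ xiP st mS S0.
Qed.

Lemma edge_prob_ae i j s : (s <= t)%N -> i != j ->
  {ae P, forall w, edge_prob B B0 Z A i j s w = edge_prob B' B0' Z A i j s w}.
Proof.
move=> st ij; have mZZ : measurable_fun setT (fun w => (Z i s w, Z j s w)).
  by apply: measurable_fun_pair; exact: mZ.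
have := ae_notin_null mZZ mN (Z_pair_null st ij mN N0).
by apply: filterS => w; case: s {st mZZ} => [|s] Nw /=; [exact: B0E|exact: BE].
Qed.

Lemma Zpath_next xi s : xi_spec xi -> (s < t)%N ->
  {ae P, forall w, Zpath Z s.+1 w =
    next_Zpath gamma B' B0' (traj_law s) (Zpath Z s w, noise_vector xi s w)}.
Proof.
move=> xiP st; apply: filterS (ae_forall_fin (fun i => Z_next i xiP st)) => w Zw.
apply: eq_from_tnth => i; rewrite !tnth_mktuple; apply: eq_from_tnth => u.
rewrite !tnth_mktuple; case: ifPn => [us|]; first by rewrite nth_traj.
rewrite -ltnNge => su; have -> : (u : nat) = s.+1.
  by apply/eqP; rewrite eqn_leq su andbT -ltnS.
exact: Zw.
Qed.

(* Conditionally on the states up to time s, the past is independent of the next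
   state, as the latter is a function of these states and of fresh noise. *)
Lemma cprob_lift s E f : (s < t)%N -> sigF Z A s E ->
  cprob P (sigG Z s) E f -> cprob P (sigG Z s.+1) E f.
Proof.
move=> st FE Ef; have [xi xiP] := Z_solves HC.
have sGs := subsigma_sigG Z s; have sF := subsigma_sigF Z A s.
have mE := sF.2 _ FE.
pose Y := noise_vector xi s.
have mY : measurable_fun setT Y := @measurable_noise_vector xi s.
have mZs : measurable_fun setT (Zpath Z s) := @measurable_Zpath _ _ _ _ _ _ Z s.
(* Up to null sets [G2] contains the events of the states up to [s.+1], which are a function of the
   states up to [s] and the noise. *)
pose G2 := g_sigma_algebra_preimage (fun w => (Zpath Z s w, Y w)).
have sG2 : subsigma G2 := subsigma_preimage (measurable_fun_pair mZs mY).
have [_ _ _ ind] := xiP.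
have Yind C S : sigF Z A s C -> measurable S ->
    (P (Y @^-1` S `&` C) = P (Y @^-1` S) * P C)%E.
  by move=> FC mS; exact: ind.
have mYS S : measurable S -> measurable (Y @^-1` S).
  by move=> mS; rewrite -[X in measurable X]setTI; exact: mY.
have G2Z : sigG Z s `<=` G2.
  by apply: g_sigma_algebra_preimage_sub => //; have [] := measurable_wrt_pair (Zpath Z s) Y.
have [mf f0 fE] := Ef.
(* Rectangles suffice. The noise is independent of [sigF], which contains both [E] and the events of
   the states up to [s], so that the probability of [S] factors out of both sides. *)
have EG2 : cprob P G2 E f.
  apply: cprob_pair => //; first exact: measurable_wrt_sub G2Z mf.
  move=> C S mC mS; set ZC := Zpath Z s @^-1` C.
  have GZC : sigG Z s ZC by exists C => //; rewrite setTI.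
  have YG : cprob P (sigG Z s) (Y @^-1` S) (cst (fine (P (Y @^-1` S)))).
    split; [exact: measurable_cst|by move=> w; exact: fine_ge0|].
    move=> D GD; rewrite Yind//; last exact: (@sigG_sigF _ _ _ _ _ _ Z A s).
    have := integral_cst P (sGs.2 _ GD) (fine (P (Y @^-1` S)))%:E => ->.
    by rewrite fineK// fin_num_measure//; exact: mYS.
  rewrite [ZC `&` _]setIC (cprob_setI_integral sGs _ YG mf f0 GZC)//; last exact: mYS.
  rewrite setICA Yind//; last first.
    by apply: (subsigmaI sF) => //; exact: (@sigG_sigF _ _ _ _ _ _ Z A s).
  transitivity (\int[P]_(w in ZC) ((f w)%:E * (fine (P (Y @^-1` S)))%:E))%E; last first.
    by apply: eq_integral => w _; rewrite EFinM.
  rewrite fE//.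
  rewrite ge0_integralZr//.
  - rewrite fineK; first exact: muleC.
    by rewrite fin_num_measure//; exact: mYS.
  - exact: sGs.2.
  - exact/measurable_EFinP/measurable_funTS/(measurable_wrtW sGs).
  - by move=> w _; rewrite lee_fin.
  - by rewrite lee_fin fine_ge0.
split => //; first exact: measurable_wrt_sub (@sigG_mono _ _ _ _ _ _ Z _ _ (leqnSn s)) mf.
move=> _ [S mS <-]; rewrite setTI.
pose C' := (fun w => next_Zpath gamma B' B0' (traj_law s) (Zpath Z s w, Y w)) @^-1` S.
have mnext := @measurable_next_Zpath R d k gamma _ _ mB mB0 B01 B001 s (traj_law s).
have GC' : G2 C'.
  exists (next_Zpath gamma B' B0' (traj_law s) @^-1` S); last by rewrite setTI.
  by rewrite -[X in measurable X]setTI; exact: mnext.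
have mC' := sG2.2 _ GC'.
have mC : measurable (Zpath Z s.+1 @^-1` S).
  by rewrite -[X in measurable X]setTI; apply: measurable_Zpath.
have CC' : {ae P, forall w, (Zpath Z s.+1 @^-1` S) w <-> C' w}.
  by apply: filterS (Zpath_next xiP st) => w /= ->.
rewrite (ae_eq_set_integral mC mC' (measurable_wrtW sGs mf) CC') -(cprobE EG2 GC').
apply: ae_eq_set_measure; [exact: measurableI|exact: measurableI|].
by apply: filterS CC' => w CC'; split => -[? /CC'].
Qed.

Lemma cprob_lift_le s r E f : (s <= r)%N -> (r <= t)%N -> sigF Z A s E ->
  cprob P (sigG Z s) E f -> cprob P (sigG Z r) E f.
Proof.
move=> sr; elim: r sr => [|r ih]; first by rewrite leqn0 => /eqP ->.
rewrite leq_eqVlt => /predU1P[->//|sr] rt FE Ef.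
apply: cprob_lift => //; last by apply: ih => //; exact: ltnW.
have : sigF Z A s `<=` sigF Z A r; last exact.
apply: g_sigma_algebra_preimage_sub; first exact: subsigma_sigF.
apply: measurable_fun_pair.
  by apply: Zpath_measurable_wrt => i u us; apply: sigF_Z; exact: (leq_trans us sr).
apply/measurable_fun_tnthP => i; apply/measurable_fun_tnthP => j.
rewrite (_ : _ \o _ = traj (A i j) s).
  by apply: measurable_wrt_traj => u us; apply: sigF_A; exact: (leq_trans us sr).
by apply/funext => w /=; rewrite !tnth_mktuple.
Qed.

(** * The conditional law of a single edge *)

Definition path_prob i j s (a : nat -> bool) (w : Omega) : R :=
  path_weight B' B0' (fun l u => Z l u w) i j s a.

Lemma path_prob_wrt i j s a (G : set (set Omega)) :
  (forall l u, (u <= s)%N -> measurable_wrt G (Z l u)) ->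
  measurable_wrt G (path_prob i j s a).
Proof.
by move=> mG; exact: (@measurable_path_weight R d k _ _ mB mB0 _ (g_sigma_algebraType G)).
Qed.

Lemma edge_prob_range i j s w : 0 <= edge_prob B' B0' Z A i j s w <= 1.
Proof. by case: s => [|s] /=. Qed.

Lemma edge_prob_wrt i j s : measurable_wrt (sigGA Z A s) (edge_prob B' B0' Z A i j s).
Proof.
have mZZ : measurable_wrt (sigGA Z A s) (fun w => (Z i s w, Z j s w)).
  by apply: measurable_fun_pair; exact: sigGA_Z.
case: s mZZ => [|s] mZZ /=; first exact: (measurableT_comp mB0 mZZ).
(* The kernels are measurable for each fixed edge value; the random value at time [s] is resolved by
   cases. *)
rewrite /measurable_wrt (_ : edge_prob _ _ _ _ _ _ _ = (fun w => if A i j s w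
    then B' true (Z i s.+1 w) (Z j s.+1 w) else B' false (Z i s.+1 w) (Z j s.+1 w))).
  apply: measurable_fun_ifT.
  - exact: (@sigGA_A _ _ _ _ _ _ Z A i j s s.+1).
  - exact: (measurableT_comp (mB true) mZZ).
  - exact: (measurableT_comp (mB false) mZZ).
by apply/funext => w /=; case: (A i j s w).
Qed.

Lemma measurable_A_preimage i j s (S : set bool) : measurable (A i j s @^-1` S).
Proof. by rewrite -[X in measurable X]setTI; exact: measurable_funP. Qed.

Lemma edge_cprob i j s b : (s <= t)%N -> i != j ->
  cprob P (sigGA Z A s) (A i j s @^-1` [set b])
    (fun w => bernoulli_weight (edge_prob B' B0' Z A i j s w) b).
Proof.
move=> st ij; have sGA := subsigma_sigGA Z A s.
have cT : cprob P (sigGA Z A s) (A i j s @^-1` [set true]) (edge_prob B' B0' Z A i j s).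
  have isE : cond_prob_is P (sigGA Z A s) (A i j s @^-1` [set true]) (edge_prob B B0 Z A i j s).
    rewrite /cond_prob_is (_ : \1_ _ = fun w => (A i j s w)%:R).
      exact: (A_cond_mean HC ij st).
    apply/funext => w; rewrite indicE; case Aw: (A i j s w).
      by rewrite mem_set.
    by rewrite memNset//= Aw.
  apply: (cond_prob_is_cprob sGA (measurable_A_preimage _ _ _ _) isE).
  - exact: edge_prob_wrt.
  - by move=> w; case/andP: (edge_prob_range i j s w).
  - exact: edge_prob_ae.
case: b => //; rewrite (_ : A i j s @^-1` _ = ~` (A i j s @^-1` [set true])).
  apply: (cprob_setC sGA (measurable_A_preimage _ _ _ _) cT) => w.
  by case/andP: (edge_prob_range i j s w).
by apply/seteqP; split => w /=; case: (A i j s w).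
Qed.

Lemma path_event_sigF i j s a : sigF Z A s (path_event A i j s a).
Proof. by apply: path_event_wrt; [exact: subsigma_sigF|move=> u; exact: sigF_A]. Qed.

(** A consequence of the common requirements alone. At each step [cprob_lift] adds the new states to
    the conditioning without altering the probability of the past path, and [cprobI] then appends
    one edge value, conditioned on the larger [sigGA]. *)
Lemma marginal_cprob i j s a : (s <= t)%N -> i != j ->
  cprob P (sigG Z s) (path_event A i j s a) (path_prob i j s a).
Proof.
move=> + ij; elim: s => [|s ih] st.
  by rewrite path_event0; exact: (edge_cprob (a 0) st ij).
rewrite path_eventS.
pose g w := bernoulli_weight (B' (a s) (Z i s.+1 w) (Z j s.+1 w)) (a s.+1).
apply: (cprobI (g := g) (subsigma_sigG Z s.+1) (subsigma_sigGA Z A s.+1)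
  (@sigG_sigGA _ _ _ _ _ _ Z A s.+1) _ (measurable_A_preimage _ _ _ _)
  (cprob_lift st (path_event_sigF i j s a) (ih (ltnW st))) (edge_cprob (a s.+1) st ij)).
- by apply: path_event_wrt; [exact: subsigma_sigGA|move=> u us; exact: sigGA_A].
- apply: measurable_bernoulli_weight.
  have mZZ : measurable_wrt (sigG Z s.+1) (fun w => (Z i s.+1 w, Z j s.+1 w)).
    by apply: measurable_fun_pair; exact: sigG_Z.
  exact: (measurableT_comp (mB (a s)) mZZ).
- by move=> w; exact: bernoulli_weight_ge0.
(* On the event that the path up to [s] is [a], the previous edge value is [a s], so the random
   transition weight is the [g] that depends on the states only. *)
- by apply: aeW => w /= h; rewrite /g h.
Qed.

Lemma marginal_cprob_le i j s r a : (s <= r)%N -> (r <= t)%N -> i != j ->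
  cprob P (sigG Z r) (path_event A i j s a) (path_prob i j s a).
Proof.
move=> sr rt ij; apply: (cprob_lift_le sr rt (path_event_sigF i j s a)).
by apply: marginal_cprob => //; exact: leq_trans rt.
Qed.

(** * The product formula and the three structures *)

Local Notation Ae e := (A (val e).1 (val e).2).
Local Notation Ze e := (fun s w => (Z (val e).1 s w, Z (val e).2 s w)).

Lemma edge_neq (e : edge k) : (val e).1 != (val e).2.
Proof. by case: e => -[i j] /= ij; apply: contraTneq ij => ->; rewrite ltnn. Qed.

Definition edge_path_prob s (a : edge k -> nat -> bool) (w : Omega) : R :=
  \prod_e path_prob (val e).1 (val e).2 s (a e) w.

Lemma edge_path_prob_wrt s r a : (s <= r)%N ->
  measurable_wrt (sigG Z r) (edge_path_prob s a).
Proof.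
move=> sr; apply: (@measurable_prod _ (g_sigma_algebraType (sigG Z r))) => e _.
by apply: path_prob_wrt => l u us; apply: sigG_Z; exact: leq_trans sr.
Qed.

Lemma edge_path_event_sigF s a : sigF Z A s (edge_path_event A s a).
Proof.
by apply: subsigma_bigcap_fin => [|e]; [exact: subsigma_sigF|exact: path_event_sigF].
Qed.

(* The common description to which all three conditional structures reduce. *)
Definition edge_paths_law s := forall a,
  cprob P (sigG Z s) (edge_path_event A s a) (edge_path_prob s a).

(** The induction of [marginal_cprob], run for all edges at once: stepwise independence makes the
    conditional probability of the joint step given [sigGA] a product. *)
Lemma edge_paths_law_stepwise : stepwise_cond_indep t _ _ P Z A ->
  forall s, (s <= t)%N -> edge_paths_law s.
Proof.
move=> ca; have step s a : (s <= t)%N ->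
    cprob P (sigGA Z A s) (\bigcap_(e in [set: edge k]) (Ae e s @^-1` [set a e]))
    (fun w => \prod_e bernoulli_weight
      (edge_prob B' B0' Z A (val e).1 (val e).2 s w) (a e)).
  move=> st; have [q qv qD] := ca s st (fun e => [set a e]) (fun _ => Logic.I).
  apply: (cond_prob_is_prod (subsigma_sigGA Z A s) _ _ qv qD) => [|e|e].
  - apply: fin_bigcap_measurable => [|e _]; first exact: finite_finset.
    exact: measurable_A_preimage.
  - exact: measurable_A_preimage.
  - exact: (edge_cprob _ st (edge_neq e)).
elim=> [|s ih] st a.
  by rewrite edge_path_event0; exact: (step 0%N (fun e => a e 0%N) st).
rewrite edge_path_eventS.
pose g w := \prod_(e : edge k) bernoulli_weight
  (B' (a e s) (Z (val e).1 s.+1 w) (Z (val e).2 s.+1 w)) (a e s.+1).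
rewrite (_ : edge_path_prob s.+1 a = fun w => edge_path_prob s a w * g w); last first.
  by apply/funext => w; rewrite -big_split.
apply: (cprobI (subsigma_sigG Z s.+1) (subsigma_sigGA Z A s.+1)
  (@sigG_sigGA _ _ _ _ _ _ Z A s.+1) _ _
  (cprob_lift st (edge_path_event_sigF s a) (ih (ltnW st) a))
  (step s.+1 (fun e => a e s.+1) st)).
- apply: subsigma_bigcap_fin => [|e]; first exact: subsigma_sigGA.
  by apply: path_event_wrt; [exact: subsigma_sigGA|move=> u us; exact: sigGA_A].
- apply: fin_bigcap_measurable => [|e _]; first exact: finite_finset.
  exact: measurable_A_preimage.
- apply: (@measurable_prod _ (g_sigma_algebraType (sigG Z s.+1))) => e _.
  apply: measurable_bernoulli_weight.
  have mZZ : measurable_wrt (sigG Z s.+1) (Ze e s.+1).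
    by apply: measurable_fun_pair; exact: sigG_Z.
  exact: (measurableT_comp (mB (a e s)) mZZ).
- by move=> w; apply: prodr_ge0 => e _; exact: bernoulli_weight_ge0.
- apply: aeW => w h; apply: eq_bigr => e _ /=; congr (bernoulli_weight (B' _ _ _) _).
  exact: (h e Logic.I s (leqnn s)).
Qed.

(** Used with [r = t] for (b) and with [r = s] for (c). The events only look at the first steps, up
    to [s], of paths up to [r]; the product of their conditional probabilities given [sigG Z r]
    involves no state after [s], so it descends to [sigG Z s]. *)
Lemma edge_paths_law_mutual r s : (s <= r)%N -> (r <= t)%N ->
  mutually_cond_independent P (sigG Z r) (fun e : edge k => traj (Ae e) r) ->
  edge_paths_law s.
Proof.
move=> sr rt ci a.
pose S e := [set x : r.+1.-tuple bool | forall u, (u <= s)%N -> nth false x u = a e u].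
have SE e : traj (Ae e) r @^-1` S e = path_event A (val e).1 (val e).2 s (a e).
  have nthE u w : (u <= s)%N -> nth false (traj (Ae e) r w) u = Ae e u w.
    move=> us; have ur : (u < r.+1)%N by exact: leq_trans us sr.
    by rewrite -[u in LHS]/(val (Ordinal ur)) -tnth_nth trajE.
  by apply/seteqP; split => w /= h u us; have := h u us; rewrite nthE.
have [q qv qD] := ci S (fun _ => measurable_bool_tuple _).
apply: (@cprob_tower _ _ _ _ (sigG Z s) (sigG Z r)).
- exact: sigG_mono.
- have qv' e : cond_prob_version P (sigG Z r)
      (path_event A (val e).1 (val e).2 s (a e)) (q e) by rewrite -SE; exact: qv.
  have qD' : cond_prob_is P (sigG Z r) (edge_path_event A s a) (fun w => \prod_e q e w).
    by rewrite /edge_path_event (eq_bigcapr (fun e _ => esym (SE e))); exact: qD.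
  apply: (cond_prob_is_prod (subsigma_sigG Z r) _ _ qv' qD') => [|e|e].
  + exact: measurable_edge_path_event.
  + exact: measurable_path_event.
  + exact: (marginal_cprob_le _ sr rt (edge_neq e)).
- exact: edge_path_prob_wrt.
Qed.

(** A set of Boolean paths is a finite disjoint union of single paths. Summing (L) over the
    admissible families of paths and applying distributivity yields the product over the edges of
    the sums. *)
Lemma mutual_edge_paths_law s : (s <= t)%N -> edge_paths_law s ->
  mutually_cond_independent P (sigG Z s) (fun e : edge k => traj (Ae e) s).
Proof.
move=> st law S _; have sG := subsigma_sigG Z s.
pose q (e : edge k) w := \sum_(x : s.+1.-tuple bool | x \in S e)
  path_prob (val e).1 (val e).2 s (nth false x) w.
exists q => [e|].
  apply: cprob_version => //.
    rewrite -[X in measurable X]setTI; apply: measurable_traj => //.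
    exact: measurable_bool_tuple.
  rewrite traj_preimage_bigcup.
  apply: (cprob_sum sG _ (@trivIset_path_event _ _ _ _ _ A _ _ s)).
    by move=> x; exact: measurable_path_event.
  by move=> x _; exact: (marginal_cprob _ st (edge_neq e)).
have cD : cprob P (sigG Z s) (\bigcap_(e in [set: edge k]) (traj (Ae e) s @^-1` S e))
    (fun w => \sum_(x in family (fun e => [pred x | x \in S e]))
      edge_path_prob s (fun e => nth false (x e)) w).
  rewrite edge_traj_preimage_bigcup.
  apply: (cprob_sum sG _ (@trivIset_edge_path_event _ _ _ _ _ A s)).
    by move=> x; exact: measurable_edge_path_event.
  by move=> x _; exact: law.
apply: (cprob_cond_prob_is sG _ cD).
  apply: fin_bigcap_measurable => [|e _]; first exact: finite_finset.
  rewrite -[X in measurable X]setTI; apply: measurable_traj => //.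
  exact: measurable_bool_tuple.
by apply: aeW => w; rewrite /q bigA_distr_big_dep.
Qed.

Definition step_prob i j s (S : set bool) (w : Omega) : R :=
  \sum_(b | b \in S) bernoulli_weight (edge_prob B' B0' Z A i j s w) b.

(** Codes the path [a] up to time [s] followed by [b]; the values after [s.+1] are never looked
    at. *)
Definition extend_path s (a : nat -> bool) (b : bool) (u : nat) : bool :=
  if (u <= s)%N then a u else b.

Lemma path_event_extend i j s a b : path_event A i j s.+1 (extend_path s a b) =
  path_event A i j s a `&` A i j s.+1 @^-1` [set b].
Proof.
rewrite path_eventS /extend_path ltnn; congr (_ `&` _).
by apply/seteqP; split => w h u us; have := h u us; rewrite us.
Qed.

Lemma path_prob_extend i j s a b w : path_prob i j s.+1 (extend_path s a b) w =
  path_prob i j s a w * bernoulli_weight (B' (a s) (Z i s.+1 w) (Z j s.+1 w)) b.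
Proof.
rewrite /path_prob /= {2 3}/extend_path leqnn ltnn; congr (_ * _).
by apply: eq_path_weight => // u us; rewrite /extend_path us.
Qed.

Lemma A_preimage_bigcup i j s (S : set bool) :
  A i j s @^-1` S = \bigcup_(b in [set` [pred b | b \in S]]) A i j s @^-1` [set b].
Proof.
apply/seteqP; split => [w Sw|w [b bS Ab]].
  2: by rewrite /preimage/= (Ab : A i j s w = b); exact: (set_mem bS).
by exists (A i j s w) => //; exact: mem_set.
Qed.

Lemma trivIset_A_preimage i j s : trivIset setT (fun b => A i j s @^-1` [set b]).
Proof.
apply/trivIsetP => b c _ _ /eqP bc; apply/seteqP; split => // w [/= bw cw].
by apply: bc; exact: etrans (esym bw) cw.
Qed.

Lemma step_cprob i j s S : (s <= t)%N -> i != j ->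
  cprob P (sigGA Z A s) (A i j s @^-1` S) (step_prob i j s S).
Proof.
move=> st ij; rewrite A_preimage_bigcup.
apply: (cprob_sum (subsigma_sigGA Z A s) _ (@trivIset_A_preimage i j s)).
  by move=> b; exact: measurable_A_preimage.
by move=> b _; exact: edge_cprob.
Qed.

(** The past of the edge takes finitely many values, which form the partition. The conditioning
    contains all states up to [t], hence also those after [s.+1]; [marginal_cprob_le] shows that
    they do not influence the edge up to [s.+1]. *)
Lemma markov_cprob i j s S : (s < t)%N -> i != j ->
  cprob P (g_sigma_algebra_preimage (fun w => (Zpath Z t w, traj (A i j) s w)))
    (A i j s.+1 @^-1` S) (step_prob i j s.+1 S).
Proof.
move=> st ij.
have mZt : measurable_fun setT (Zpath Z t) := @measurable_Zpath _ _ _ _ _ _ Z t.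
have mAs : measurable_fun setT (traj (A i j) s) := @measurable_traj _ _ _ _ _ _ (A i j) s.
rewrite A_preimage_bigcup.
apply: (cprob_sum (subsigma_preimage (measurable_fun_pair mZt mAs)) _
  (@trivIset_A_preimage i j s.+1)); first by move=> b; exact: measurable_A_preimage.
move=> b _; have [wZ wA] := measurable_wrt_pair (Zpath Z t) (traj (A i j) s).
have w0 w : 0 <= bernoulli_weight (edge_prob B' B0' Z A i j s.+1 w) b.
  exact: bernoulli_weight_ge0 (edge_prob_range i j s.+1 w).
apply: (@cprob_pair_partition _ _ _ P _
  (fun x : s.+1.-tuple bool => path_event A i j s (nth false x)) _ _ _ _ _ _ _ _ _ id _ _
  mZt mAs _ _ _ w0).
- by move=> x; exact: measurable_path_event.
- exact: trivIset_path_event.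
- by move=> w; exists (traj (A i j) s w); apply/path_event_nth.
- exact: measurable_A_preimage.
- by apply: aeW => w x /path_event_nth.
- apply: measurable_bernoulli_weight; rewrite (_ : edge_prob _ _ _ _ _ _ _ = (fun w =>
    if tnth (traj (A i j) s w) ord_max
    then B' true (Z i s.+1 w) (Z j s.+1 w) else B' false (Z i s.+1 w) (Z j s.+1 w))).
    have mZZ : measurable_wrt
        (g_sigma_algebra_preimage (fun w => (Zpath Z t w, traj (A i j) s w)))
        (fun w => (Z i s.+1 w, Z j s.+1 w)).
      by apply: measurable_fun_pair; exact: measurable_wrt_Zpath st wZ.
    apply: measurable_fun_ifT.
    - exact: (measurableT_comp (measurable_tnth ord_max) wA).
    - exact: (measurableT_comp (mB true) mZZ).
    - exact: (measurableT_comp (mB false) mZZ).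
  by apply/funext => w; rewrite trajE /=; case: (A i j s w).
- move=> x C mC; set a := nth false x.
  have GC : sigG Z t (Zpath Z t @^-1` C) by exists C => //; rewrite setTI.
  have sG := subsigma_sigG Z t.
  pose g w := bernoulli_weight (B' (a s) (Z i s.+1 w) (Z j s.+1 w)) b.
  have mg : measurable_wrt (sigG Z t) g.
    apply: measurable_bernoulli_weight.
    have mZZ : measurable_wrt (sigG Z t) (fun w => (Z i s.+1 w, Z j s.+1 w)).
      by apply: measurable_fun_pair; exact: sigG_Z.
    exact: (measurableT_comp (mB (a s)) mZZ).
  have g0 w : 0 <= g w by exact: bernoulli_weight_ge0.
  rewrite setIA [A i j s.+1 @^-1` _ `&` _]setIC -path_event_extend.
  rewrite (cprobE (marginal_cprob_le (extend_path s a b) st (leqnn t) ij) GC).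
  (* Instead of dividing path weights, [g] is integrated over the event of the past: the weight of
     the extended path is that of the past times [g], and on this event [g] is the wanted transition
     weight. *)
  transitivity (\int[P]_(w in path_event A i j s a `&` Zpath Z t @^-1` C) (g w)%:E)%E.
    rewrite (cprob_setI_integral sG (measurable_path_event _ _ _ _ _)
      (marginal_cprob_le a (ltnW st) (leqnn t) ij) mg g0 GC).
    by apply: eq_integral => w _; rewrite path_prob_extend mulrC.
  by apply: eq_integral => w; rewrite inE => -[aw _]; rewrite /g /= aw.
Qed.

(* The adjacency path recovered from the edges i < j by symmetry, with the value
   true on the diagonal. *)
Definition full_Apath s (x : {ffun edge k -> s.+1.-tuple bool}) :
    k.-tuple (k.-tuple (s.+1.-tuple bool)) :=
  [tuple [tuple
    if (insub (i, j) : option {e : 'I_k * 'I_k | (e.1 < e.2)%N}) is Some e then x e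
    else if (insub (j, i) : option {e : 'I_k * 'I_k | (e.1 < e.2)%N}) is Some e then x e
    else [tuple true | _ < s.+1] | j < k] | i < k].

Lemma Apath_full s : (s <= t)%N -> {ae P, forall w,
  forall x : {ffun edge k -> s.+1.-tuple bool},
    edge_path_event A s (fun e => nth false (x e)) w -> Apath A s w = full_Apath x}.
Proof.
move=> st.
have sym : {ae P, forall w, forall ij u, (u <= s)%N -> A ij.1 ij.2 u w = A ij.2 ij.1 u w}.
  apply: ae_forall_fin => ij; apply: ae_forall_le => u us.
  by apply: (A_symmetric HC); exact: leq_trans st.
have diag : {ae P, forall w, forall i u, (u <= s)%N -> A i i u w = true}.
  apply: ae_forall_fin => i; apply: ae_forall_le => u us.
  by apply: (A_diagonal HC); exact: leq_trans st.
apply: filterS2 sym diag => w sym diag x xw.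
apply: eq_from_tnth => i; rewrite !tnth_mktuple; apply: eq_from_tnth => j.
rewrite !tnth_mktuple; case: insubP => [e _ eij|].
  by have /path_event_nth <- := xw e Logic.I; rewrite eij.
rewrite /= -leqNgt => ji; case: insubP => [e _ eij|].
  have /path_event_nth <- := xw e Logic.I; rewrite eij /=.
  apply: eq_from_tnth => u; rewrite !trajE; apply: (sym (i, j)).
  by rewrite -ltnS.
rewrite /= -leqNgt => ij; have -> : j = i.
  by apply/val_inj/eqP; rewrite eqn_leq ji.
apply: eq_from_tnth => u; rewrite trajE tnth_mktuple; apply: diag.
by rewrite -ltnS.
Qed.

(** On a fixed past of all edges, (L) at time [s.+1], summed over the admissible last values, is (L)
    at time [s] times a product of sums of transition weights. [Apath_full] ensures that the pasts
    of the edges exhaust the adjacency part of [sigGA]. *)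
Lemma stepwise_edge_paths_law : (forall s, (s <= t)%N -> edge_paths_law s) ->
  stepwise_cond_indep t _ _ P Z A.
Proof.
move=> law [|s] st.
  (* At time 0, [sigGA] is [sigG] and a path is a 1-tuple, from which its entry is extracted. *)
  have mh : measurable_fun setT (fun x : 1.-tuple bool => tnth x ord0).
    exact: measurable_tnth.
  have := mutually_cond_independent_comp mh (mutual_edge_paths_law st (law _ st)).
  congr (mutually_cond_independent _ _ _); apply/funext => e; apply/funext => w.
  by rewrite /= trajE.
move=> S _; have sG := subsigma_sigG Z s.+1; have sGA := subsigma_sigGA Z A s.+1.
exists (fun e => step_prob (val e).1 (val e).2 s.+1 (S e)) => [e|].
  apply: (cprob_version sGA (measurable_A_preimage _ _ _ _)).
  exact: (step_cprob _ st (edge_neq e)).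
have mD : measurable (\bigcap_(e in [set: edge k]) (Ae e s.+1 @^-1` S e)).
  apply: fin_bigcap_measurable => [|e _]; first exact: finite_finset.
  exact: measurable_A_preimage.
have mZs : measurable_fun setT (Zpath Z s.+1) := @measurable_Zpath _ _ _ _ _ _ Z s.+1.
have mAs : measurable_fun setT (Apath A s) := @measurable_Apath _ _ _ _ _ A s.
apply: (@cprob_cond_prob_is _ _ _ P _ _
  (fun w => \prod_(e : edge k) step_prob (val e).1 (val e).2 s.+1 (S e) w) _ sGA mD);
  last exact: aeW.
have step_ge0 i j r T w : 0 <= step_prob i j r T w.
  by apply: sumr_ge0 => b _; exact: bernoulli_weight_ge0 (edge_prob_range i j r w).
apply: (@cprob_pair_partition _ _ _ P _
  (fun x : {ffun edge k -> s.+1.-tuple bool} =>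
    edge_path_event A s (fun e => nth false (x e))) _ _ _ _ _ _ _ _ _ (@full_Apath s) _ _
  mZs mAs mD _ _ _).
- by move=> x; exact: measurable_edge_path_event.
- exact: trivIset_edge_path_event.
- exact: edge_path_event_cover.
- exact: (Apath_full (ltnW st)).
- apply: (@measurable_prod _ (g_sigma_algebraType (sigGA Z A s.+1))) => e _.
  by have [] := step_cprob (S e) st (edge_neq e).
- by move=> w; apply: prodr_ge0.
move=> x C mC; set a := fun e => nth false (x e).
have GC : sigG Z s.+1 (Zpath Z s.+1 @^-1` C) by exists C => //; rewrite setTI.
(* The product of the step probabilities with the previous edge values frozen at [a]; unlike these,
   it depends on the states only. *)
pose g w := \prod_(e : edge k) \sum_(b | b \in S e) bernoulli_weight
  (B' (a e s) (Z (val e).1 s.+1 w) (Z (val e).2 s.+1 w)) b.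
have g0 w : 0 <= g w.
  by apply: prodr_ge0 => e _; apply: sumr_ge0 => b _; exact: bernoulli_weight_ge0.
have mg : measurable_wrt (sigG Z s.+1) g.
  apply: (@measurable_prod _ (g_sigma_algebraType (sigG Z s.+1))) => e _.
  under eq_fun do rewrite big_mkcond.
  apply: (@measurable_sum _ (g_sigma_algebraType (sigG Z s.+1))) => b.
  case: (boolP (b \in S e)) => _; last exact: measurable_cst.
  apply: measurable_bernoulli_weight.
  have mZZ : measurable_wrt (sigG Z s.+1) (Ze e s.+1).
    by apply: measurable_fun_pair; exact: sigG_Z.
  exact: (measurableT_comp (mB (a e s)) mZZ).
(* [c] runs over the last values of all edges, appended to the fixed past [a]. *)
pose ext (c : {ffun edge k -> bool}) e := extend_path s (a e) (c e).
have cDx : cprob P (sigG Z s.+1)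
    (\bigcup_(c in [set` family (fun e => [pred b | b \in S e])])
      edge_path_event A s.+1 (ext c))
    (fun w => \sum_(c in family (fun e => [pred b | b \in S e])) edge_path_prob s.+1 (ext c) w).
  apply: (cprob_sum sG).
  - by move=> c; exact: measurable_edge_path_event.
  - apply/trivIsetP => c c' _ _ /eqP cc'; apply/seteqP; split => // w [cw cw'].
    apply: cc'; apply/ffunP => e.
    have := cw e Logic.I s.+1 (leqnn _); have := cw' e Logic.I s.+1 (leqnn _).
    by rewrite /ext /extend_path ltnn => -> .
  - by move=> c _; exact: law.
rewrite setIA (_ : \bigcap_(e in [set: edge k]) (Ae e s.+1 @^-1` S e) `&`
    edge_path_event A s a = \bigcup_(c in [set` family (fun e => [pred b | b \in S e])])
    edge_path_event A s.+1 (ext c)); last first.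
  apply/seteqP; split => [w [Sw aw]|w [c /= cS cw]].
    exists [ffun e => Ae e s.+1 w].
      by apply/familyP => e; rewrite ffunE; apply: mem_set; exact: (Sw e Logic.I).
    move=> e _; rewrite /ext ffunE path_event_extend; split => //; exact: (aw e Logic.I).
  split => e _; have := cw e Logic.I; rewrite /ext path_event_extend => -[h1 h2] //.
  rewrite /preimage/= (h2 : Ae e s.+1 w = c e); apply: set_mem.
  by move/familyP : cS => /(_ e).
rewrite (cprobE cDx GC).
transitivity (\int[P]_(w in edge_path_event A s a `&` Zpath Z s.+1 @^-1` C) (g w)%:E)%E.
  rewrite (cprob_setI_integral sG (measurable_edge_path_event _ _ _)
    (cprob_lift st (edge_path_event_sigF s a) (law s (ltnW st) a)) mg g0 GC).
  apply: eq_integral => w _; congr (_%:E); rewrite /g /edge_path_prob -big_split/=.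
  under [RHS]eq_bigr do rewrite big_distrl/=.
  rewrite bigA_distr_big_dep/=; apply: eq_bigr => c _; apply: eq_bigr => e _.
  by rewrite /ext path_prob_extend mulrC.
apply: eq_integral => w; rewrite inE => -[aw _]; congr (_%:E).
apply: eq_bigr => e _; apply: eq_bigr => b _ /=.
by rewrite (aw e Logic.I s (leqnn s)).
Qed.

(** [step_prob] depends on the past of the edge only through its last value. It is thus measurable
    for the smaller conditioning, to which [markov_cprob] descends, and one function is a version
    for both sides of the Markov property. *)
Lemma markov_chain_conditions (i j : 'I_k) : i != j ->
  [/\ cond_markov_chain (sigG Z t) (A i j) t,
      cond_prob_is P (sigG Z t) (A i j 0 @^-1` [set true])
        (fun w => B0 (Z i 0 w) (Z j 0 w)) &
      forall s a, (s < t)%N ->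
        cond_prob_at_is P (sigG Z t) (A i j s.+1 @^-1` [set true]) (A i j s) a
          (fun w => B a (Z i s.+1 w) (Z j s.+1 w))].
Proof.
move=> ij.
have mZt : measurable_fun setT (Zpath Z t) := @measurable_Zpath _ _ _ _ _ _ Z t.
have mA s : measurable_fun setT (A i j s) := measurable_funPT (A i j s).
have mtr s : measurable_fun setT (traj (A i j) s) := @measurable_traj _ _ _ _ _ _ (A i j) s.
have now s S : (s < t)%N ->
    cprob P (sigma_join (sigG Z t) (g_sigma_algebra_preimage (A i j s)))
      (A i j s.+1 @^-1` S) (step_prob i j s.+1 S).
  move=> st; rewrite sigma_join_preimage.
  apply: cprob_tower (markov_cprob S st ij) _.
    apply: g_sigma_algebra_preimage_sub.
      exact: subsigma_preimage (measurable_fun_pair mZt (mtr s)).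
    have [wZ wA] := measurable_wrt_pair (Zpath Z t) (traj (A i j) s).
    apply: measurable_fun_pair => //.
    rewrite (_ : (A i j s : _ -> _) = (fun x => tnth x ord_max) \o traj (A i j) s).
      exact: (measurableT_comp (measurable_tnth ord_max) wA).
    by apply/funext => w /=; rewrite trajE.
  have [wZ wA] := measurable_wrt_pair (Zpath Z t) (A i j s).
  rewrite (_ : step_prob i j s.+1 S = fun w => \sum_b if b \in S then
      bernoulli_weight (edge_prob B' B0' Z A i j s.+1 w) b else 0); last first.
    by apply/funext => w; rewrite /step_prob big_mkcond.
  apply: (@measurable_sum _ (g_sigma_algebraType
    (g_sigma_algebra_preimage (fun w => (Zpath Z t w, A i j s w))))) => b.
  case: (boolP (b \in S)) => _; last exact: measurable_cst.
  apply: measurable_bernoulli_weight; rewrite (_ : edge_prob _ _ _ _ _ _ _ = (fun w =>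
    if A i j s w
    then B' true (Z i s.+1 w) (Z j s.+1 w) else B' false (Z i s.+1 w) (Z j s.+1 w))).
    have mZZ : measurable_wrt (g_sigma_algebra_preimage (fun w => (Zpath Z t w, A i j s w)))
        (fun w => (Z i s.+1 w, Z j s.+1 w)).
      by apply: measurable_fun_pair; exact: measurable_wrt_Zpath st wZ.
    apply: measurable_fun_ifT => //.
    - exact: (measurableT_comp (mB true) mZZ).
    - exact: (measurableT_comp (mB false) mZZ).
  by apply/funext => w /=; case: (A i j s w).
have sJ s : subsigma (sigma_join (sigG Z t) (g_sigma_algebra_preimage (A i j s))).
  by rewrite sigma_join_preimage; exact: subsigma_preimage (measurable_fun_pair mZt (mA s)).
split.
- move=> s S st _; exists (step_prob i j s.+1 S).
    exact: (cprob_version (sJ s) (measurable_A_preimage _ _ _ _) (now s S st)).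
  exists (step_prob i j s.+1 S); last exact: aeW.
  rewrite sigma_join_preimage; apply: cprob_version.
  + exact: subsigma_preimage (measurable_fun_pair mZt (mtr s)).
  + exact: measurable_A_preimage.
  + exact: markov_cprob.
(* The constant path [true] is read at time 0 only. *)
- have := marginal_cprob_le (fun _ => true) (leq0n t) (leqnn t) ij.
  rewrite path_event0 => c0.
  apply: (cprob_cond_prob_is (subsigma_sigG Z t) (measurable_A_preimage _ _ _ _) c0).
  by apply: filterS (edge_prob_ae (leq0n t) ij) => w /= ->.
- move=> s a st; exists (step_prob i j s.+1 [set true]).
    exact: (cprob_version (sJ s) (measurable_A_preimage _ _ _ _) (now s _ st)).
  apply: filterS (edge_prob_ae st ij) => w /= E Aa; rewrite -Aa E.
  rewrite /step_prob (big_pred1 true)// => b.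
  by apply/idP/eqP => [/set_mem//|->]; exact: mem_set.
Qed.

Lemma pathwise_iff : pathwise_cond_indep t _ _ P Z A <->
  (forall s, (s <= t)%N -> edge_paths_law s).
Proof.
split=> [cc s st|law s st]; last exact: (mutual_edge_paths_law st (law s st)).
exact: (edge_paths_law_mutual (leqnn s) st (cc s st)).
Qed.

Lemma chains_iff : cond_indep_markov_chains B B0 t _ _ P Z A <->
  (forall s, (s <= t)%N -> edge_paths_law s).
Proof.
split=> [[ci _] s st|law]; first exact: (edge_paths_law_mutual st (leqnn t) ci).
split; first exact: (mutual_edge_paths_law (leqnn t) (law t (leqnn t))).
by move=> i j ij; apply: markov_chain_conditions; apply: contraTneq ij => ->; rewrite ltnn.
Qed.

Lemma stepwise_iff : stepwise_cond_indep t _ _ P Z A <->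
  (forall s, (s <= t)%N -> edge_paths_law s).
Proof.
by split; [exact: edge_paths_law_stepwise|exact: stepwise_edge_paths_law].
Qed.

Definition joint_weight (x : {ffun edge k -> t.+1.-tuple bool})
    (z : k.-tuple (t.+1.-tuple V)) : R :=
  \prod_(e : edge k) path_weight B' B0' (fun i u => (tnth z i)`_u)
    (val e).1 (val e).2 t (nth false (x e)).

(** The edge paths split the event into finitely many parts. On each of them the adjacency path is
    almost surely [full_Apath x], which leaves an event of the states, to which (L) applies; the
    integral is then transported to path space. The result depends on the pair through the law of
    [Zpath] only. *)
Lemma joint_law_formula U : edge_paths_law t -> measurable U ->
  (P ((fun w => (Zpath Z t w, Apath A t w)) @^-1` U) =
   \sum_(x : {ffun edge k -> t.+1.-tuple bool})
     \int[pushforward P (Zpath Z t)]_(z in (fun z => (z, full_Apath x)) @^-1` U)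
       (joint_weight x z)%:E)%E.
Proof.
move=> law mU.
have mZt : measurable_fun setT (Zpath Z t) := @measurable_Zpath _ _ _ _ _ _ Z t.
have mAt : measurable_fun setT (Apath A t) := @measurable_Apath _ _ _ _ _ A t.
have mC : measurable ((fun w => (Zpath Z t w, Apath A t w)) @^-1` U).
  by rewrite -[X in measurable X]setTI; exact: (measurable_fun_pair mZt mAt).
rewrite (@measure_partition _ _ _ P _ (fun x : {ffun edge k -> t.+1.-tuple bool} =>
    edge_path_event A t (fun e => nth false (x e))) _ _ _ _ mC); last 3 first.
- by move=> x; exact: measurable_edge_path_event.
- exact: trivIset_edge_path_event.
- exact: edge_path_event_cover.
apply: eq_bigr => x _;
set Ux := (fun z : k.-tuple (t.+1.-tuple V) => (z, full_Apath x)) @^-1` U.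
have mUx : measurable Ux.
  by rewrite -[X in measurable X]setTI; exact: (@pair2_measurable _ _ _ _ (full_Apath x)).
have mZUx : measurable (Zpath Z t @^-1` Ux).
  by rewrite -[X in measurable X]setTI; exact: mZt.
transitivity (P (edge_path_event A t (fun e => nth false (x e)) `&` Zpath Z t @^-1` Ux)).
  apply: ae_eq_set_measure.
  - by apply: measurableI => //; exact: measurable_edge_path_event.
  - by apply: measurableI => //; exact: measurable_edge_path_event.
  - apply: filterS (Apath_full (leqnn t)) => w full; rewrite /Ux /=.
    by split => -[xw]; rewrite (full x xw).
have GU : sigG Z t (Zpath Z t @^-1` Ux) by exists Ux => //; rewrite setTI.
rewrite (cprobE (law (fun e => nth false (x e))) GU).
have mw : measurable_fun setT (fun z => joint_weight x z).
  apply: measurable_prod => e _.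
  apply: (measurable_path_weight mB mB0) => l u ut.
  exact: (measurableT_comp (@measurable_tuple_nth _ _ _ u) (measurable_tnth l)).
rewrite (@ge0_integral_pushforward _ _ _ _ _ _ mZt P Ux (fun z => (joint_weight x z)%:E) mUx).
- apply: eq_integral => w _; congr (_%:E); apply: eq_bigr => e _.
  by apply: eq_path_weight => // l u ut; rewrite tnth_mktuple nth_traj.
- exact/measurable_EFinP/measurable_funTS.
- by move=> z _; rewrite lee_fin; apply: prodr_ge0 => e _; exact: path_weight_ge0.
Qed.

End dynamics.

(** * Uniqueness of the law *)

Section tuple_laws.
Context {R : realType} d (T : measurableType d) (k : nat).

Definition box (S : 'I_k -> set T) : set (k.-tuple T) :=
  \bigcap_(i in [set: 'I_k]) ((@tnth k T)^~ i @^-1` S i).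

Lemma measurable_box S : (forall i, measurable (S i)) -> measurable (box S).
Proof.
move=> mS; apply: fin_bigcap_measurable => [|i _]; first exact: finite_finset.
by rewrite -[X in measurable X]setTI; exact: measurable_tnth.
Qed.

(** The cylinders over one coordinate generate by definition, but only boxes are stable under
    intersection, as uniqueness of measures requires. *)
Lemma measurable_tupleE : @measurable _ (k.-tuple T) =
  <<s [set box S | S in [set S | forall i, measurable (S i)]] >>.
Proof.
apply/seteqP; split; last first.
  apply: smallest_sub; first exact: sigma_algebra_measurable.
  by move=> _ [S mS <-]; exact: measurable_box.
apply: smallest_sub; first exact: smallest_sigma_algebra.
rewrite -bigcup_seq => _ [i _ [C mC <-]]; apply: sub_sigma_algebra.
exists (fun j => if j == i then C else setT); first by move=> j /=; case: ifP.
rewrite setTI; apply/seteqP; split => [x h|x h j _ /=].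
  by have := h i Logic.I; rewrite /= eqxx.
by case: eqP => [->|].
Qed.

Lemma tuple_law_unique (m m' : probability (k.-tuple T) R) :
  (forall S, (forall i, measurable (S i)) -> m (box S) = m' (box S)) ->
  forall U, measurable U -> m U = m' U.
Proof.
move=> mm' U mU; apply: (measure_unique _ (fun=> setT) measurable_tupleE) => //.
- move=> _ _ [S mS <-] [S' mS' <-]; exists (fun i => S i `&` S' i).
    by move=> i; exact: measurableI.
  apply/seteqP; split => [x h|x [h h'] i _].
    by split => i _; have [] := h i Logic.I.
  by split; [exact: h|exact: h'].
- move=> _; exists (fun=> setT); first by [].
  by apply/seteqP; split.
- by rewrite bigcup_const.
- by move=> _ [S mS <-]; exact: mm'.
- by move=> _; rewrite ltey_eq fin_num_measure.
Qed.

End tuple_laws.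

Lemma independent_tuple_law (R : realType) d (T : measurableType d) (k : nat)
    (m : set T -> \bar R)
    d1 (O1 : measurableType d1) (P1 : probability O1 R) (X1 : 'I_k -> O1 -> T)
    d2 (O2 : measurableType d2) (P2 : probability O2 R) (X2 : 'I_k -> O2 -> T) :
  (forall i, measurable_fun setT (X1 i)) -> (forall i, measurable_fun setT (X2 i)) ->
  mutually_independent P1 X1 -> mutually_independent P2 X2 ->
  (forall i S, measurable S -> P1 (X1 i @^-1` S) = m S) ->
  (forall i S, measurable S -> P2 (X2 i @^-1` S) = m S) ->
  forall U, measurable U -> P1 ((fun w => [tuple X1 i w | i < k]) @^-1` U) =
    P2 ((fun w => [tuple X2 i w | i < k]) @^-1` U).
Proof.
move=> mX1 mX2 I1 I2 E1 E2.
have mt1 : measurable_fun setT (fun w => [tuple X1 i w | i < k]).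
  apply/measurable_fun_tnthP => i; rewrite (_ : _ \o _ = X1 i)//.
  by apply/funext => w /=; rewrite tnth_mktuple.
have mt2 : measurable_fun setT (fun w => [tuple X2 i w | i < k]).
  apply/measurable_fun_tnthP => i; rewrite (_ : _ \o _ = X2 i)//.
  by apply/funext => w /=; rewrite tnth_mktuple.
apply: (@tuple_law_unique _ _ _ _ (distribution P1 (rv_of P1 mt1))
  (distribution P2 (rv_of P2 mt2))) => S mS.
have boxE O (X : 'I_k -> O -> T) : (fun w => [tuple X i w | i < k]) @^-1` box S =
    \bigcap_(i in [set: 'I_k]) (X i @^-1` S i).
  by apply/seteqP; split => w h i _; have := h i Logic.I; rewrite /= tnth_mktuple.
transitivity (P1 (\bigcap_(i in [set: 'I_k]) (X1 i @^-1` S i))).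
  by congr (P1 _); exact: boxE.
transitivity (P2 (\bigcap_(i in [set: 'I_k]) (X2 i @^-1` S i))); last first.
  by congr (P2 _); rewrite -boxE.
have := I1 S mS => ->; have := I2 S mS => ->.
by apply: eq_bigr => i _; rewrite E1// E2.
Qed.

Lemma noise_family_slice (R : realType) (d k t : nat) disp (Omega : measurableType disp)
    (P : probability Omega R) (xi : 'I_k -> nat -> {RV P >-> 'rV[R]_d}) s :
  (s < t)%N -> mutually_independent P (@noise_family R d k t _ _ P xi) ->
  mutually_independent P (fun i => xi i s).
Proof.
(* The other times get the whole space and contribute factors 1. *)
move=> st fam S mS; pose F (p : 'I_k * 'I_t) := if p.2 == Ordinal st then S p.1 else setT.
have mF p : measurable (F p) by rewrite /F; case: ifP.
have := fam F mF; rewrite (_ : \bigcap_i _ = \bigcap_i (xi i s @^-1` S i)); last first.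
  apply/seteqP; split => [w h i _|w h [i u] _].
    by have := h (i, Ordinal st) Logic.I; rewrite /F /= eqxx.
  by rewrite /F /noise_family /=; case: eqP => // ->; exact: h.
move=> ->; rewrite -(pair_big xpredT xpredT
  (fun i u => P (@noise_family R d k t _ _ P xi (i, u) @^-1` F (i, u))))/=.
apply: eq_bigr => i _; rewrite (bigD1 (Ordinal st))//= {1}/F eqxx big1 ?mule1//.
by move=> u /negbTE us; rewrite /F /= us preimage_setT probability_setT.
Qed.

Section uniqueness.
Context {R : realType} {d k t : nat}.
Local Notation V := 'rV[R]_d.
Variables (gamma : R) (B B' : bool -> V -> V -> R) (B0 B0' : V -> V -> R)
  (N : set (V * V)) (mu0 noise : probability V R).
Hypothesis mB : forall a, measurable_fun setT (fun z : V * V => B' a z.1 z.2).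
Hypothesis mB0 : measurable_fun setT (fun z : V * V => B0' z.1 z.2).
Hypothesis B01 : forall a x y, 0 <= B' a x y <= 1.
Hypothesis B001 : forall x y, 0 <= B0' x y <= 1.
Hypothesis mN : measurable N.
Hypothesis N0 : (lebesgue_rV R d \x lebesgue_rV R d)%E N = 0%E.
Hypothesis BE : forall a x y, ~ N (x, y) -> B a x y = B' a x y.
Hypothesis B0E : forall x y, ~ N (x, y) -> B0 x y = B0' x y.
Hypothesis mu0_ac : mu0 `<< lebesgue_rV R d.
Hypothesis noise_ac : noise `<< lebesgue_rV R d.
Variable i1 : 'I_k.

Context {d1 : measure_display} {O1 : measurableType d1} {P1 : probability O1 R}.
Variables (Z1 : 'I_k -> nat -> {RV P1 >-> V}) (A1 : 'I_k -> 'I_k -> nat -> {RV P1 >-> bool}).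
Hypothesis H1 : common_requirements gamma B B0 mu0 noise t Z1 A1 i1.

Context {d2 : measure_display} {O2 : measurableType d2} {P2 : probability O2 R}.
Variables (Z2 : 'I_k -> nat -> {RV P2 >-> V}) (A2 : 'I_k -> 'I_k -> nat -> {RV P2 >-> bool}).
Hypothesis H2 : common_requirements gamma B B0 mu0 noise t Z2 A2 i1.

(** The law enters through integrals only, so agreement on measurable sets suffices; as set
    functions, [mu] and [mu'] may differ elsewhere. *)
Lemma next_Zpath_eq_law s (mu mu' : probability (s.+1.-tuple V) R) p :
  (forall S, measurable S -> mu S = mu' S) ->
  @next_Zpath R d k gamma B' B0' s mu p = next_Zpath gamma B' B0' mu' p.
Proof.
move=> mm'; apply: eq_from_tnth => i; rewrite !tnth_mktuple.
apply: eq_from_tnth => u; rewrite !tnth_mktuple; case: ifP => // _.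
congr (_ + _); congr (_ + _ *: _); apply/rowP => j; rewrite !mxE.
by congr (fine _ / fine _); apply: eq_measure_integral => S mS _; exact: mm'.
Qed.

Lemma traj0E disp (Omega : measurableType disp) (P : probability Omega R)
    (X : nat -> {RV P >-> V}) : traj X 0 = (fun v => [tuple v | _ < 1]) \o X 0.
Proof.
apply/funext => w; apply: eq_from_tnth => u; rewrite trajE tnth_mktuple.
by rewrite (ord1 u).
Qed.

Lemma mutually_independent_traj0 disp (Omega : measurableType disp)
    (P : probability Omega R) (Z : 'I_k -> nat -> {RV P >-> V}) :
  mutually_independent P (fun i => Z i 0) ->
  mutually_independent P (fun i => traj (Z i) 0).
Proof.
have mh : measurable_fun setT (fun v : V => [tuple v | _ < 1]).
  apply/measurable_fun_tnthP => u; rewrite (_ : _ \o _ = id)//.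
  by apply/funext => v /=; rewrite tnth_mktuple.
move=> ind S mS; have := ind (fun i => (fun v : V => [tuple v | _ < 1]) @^-1` S i) _.
under [in X in _ -> X]eq_bigcapr do rewrite traj0E.
under [in X in _ -> X]eq_bigr do rewrite traj0E.
by apply=> i; rewrite -[X in measurable X]setTI; exact: mh.
Qed.

(** The induction carries the joint law of all particles: the law in the drift is one of its
    marginals, and the next joint path is the image of a pair whose law is the product of it with
    the law of the noise vector. *)
Lemma Zpath_law_unique s U : (s <= t)%N -> measurable U ->
  P1 (Zpath Z1 s @^-1` U) = P2 (Zpath Z2 s @^-1` U).
Proof.
elim: s U => [|s ih] U st mU.
  pose m S := mu0 ((fun v : V => [tuple v | _ < 1]) @^-1` S).
  have mh : measurable_fun setT (fun v : V => [tuple v | _ < 1]).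
    apply/measurable_fun_tnthP => u; rewrite (_ : _ \o _ = id)//.
    by apply/funext => v /=; rewrite tnth_mktuple.
  apply: (@independent_tuple_law R _ _ k m _ _ P1 (fun i => traj (Z1 i) 0)
    _ _ P2 (fun i => traj (Z2 i) 0)) => //.
  - by move=> i; exact: measurable_traj.
  - by move=> i; exact: measurable_traj.
  - exact: mutually_independent_traj0 (Z0_independent H1).
  - exact: mutually_independent_traj0 (Z0_independent H2).
  - move=> i S mS; rewrite traj0E comp_preimage (Z0_law H1)//.
    by rewrite -[X in measurable X]setTI; exact: mh.
  - move=> i S mS; rewrite traj0E comp_preimage (Z0_law H2)//.
    by rewrite -[X in measurable X]setTI; exact: mh.
have [xi1 X1] := Z_solves H1; have [xi2 X2] := Z_solves H2.
have mZ1 := @measurable_Zpath _ _ _ _ _ _ Z1.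
have mZ2 := @measurable_Zpath _ _ _ _ _ _ Z2.
have mY1 := @measurable_noise_vector R d k _ _ P1 xi1 s.
have mY2 := @measurable_noise_vector R d k _ _ P2 xi2 s.
have lawE S : measurable S -> traj_law Z1 i1 s S = traj_law Z2 i1 s S.
  move=> mS; pose S' := (fun x : k.-tuple (s.+1.-tuple V) => tnth x i1) @^-1` S.
  have mS' : measurable S'.
    by rewrite -[X in measurable X]setTI; exact: measurable_tnth.
  have := ih S' (ltnW st) mS'.
  rewrite /traj_law /distribution /pushforward /=.
  by congr (_ = _); [congr (P1 _)|congr (P2 _)];
    apply/seteqP; split => w; rewrite /S' /= tnth_mktuple.
have noiseE S : measurable S ->
    P1 (noise_vector xi1 s @^-1` S) = P2 (noise_vector xi2 s @^-1` S).
  have [_ fam1 law1 _] := X1; have [_ fam2 law2 _] := X2.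
  apply: (@independent_tuple_law R _ _ k noise _ _ P1 (fun i => xi1 i s)
    _ _ P2 (fun i => xi2 i s)) => //.
  - exact: noise_family_slice st fam1.
  - exact: noise_family_slice st fam2.
  - by move=> i S' mS'; exact: law1.
  - by move=> i S' mS'; exact: law2.
pose next := @next_Zpath R d k gamma B' B0' s (traj_law Z1 i1 s).
have mnext : measurable_fun setT next.
  exact: (@measurable_next_Zpath R d k gamma _ _ mB mB0 B01 B001 s (traj_law Z1 i1 s)).
have mM : measurable (next @^-1` U) by rewrite -[X in measurable X]setTI; exact: mnext.
have nextE1 : P1 (Zpath Z1 s.+1 @^-1` U) =
    P1 ((fun w => (Zpath Z1 s w, noise_vector xi1 s w)) @^-1` (next @^-1` U)).
  apply: ae_eq_set_measure.
  - by rewrite -[X in measurable X]setTI; exact: mZ1.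
  - by rewrite -[X in measurable X]setTI; exact: (measurable_fun_pair (mZ1 _) mY1).
  - have := Zpath_next mB mB0 B01 B001 mN N0 BE B0E mu0_ac noise_ac H1 X1 st.
    by apply: filterS => w /= ->.
have nextE2 : P2 (Zpath Z2 s.+1 @^-1` U) =
    P2 ((fun w => (Zpath Z2 s w, noise_vector xi2 s w)) @^-1` (next @^-1` U)).
  apply: ae_eq_set_measure.
  - by rewrite -[X in measurable X]setTI; exact: mZ2.
  - by rewrite -[X in measurable X]setTI; exact: (measurable_fun_pair (mZ2 _) mY2).
  - have := Zpath_next mB mB0 B01 B001 mN N0 BE B0E mu0_ac noise_ac H2 X2 st.
    (* The second process moves by the map of its own law, which [lawE] turns into that of the
       first. *)
    by apply: filterS => w /= ->; rewrite /next (next_Zpath_eq_law _ lawE).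
have ind1 : independent P1 (Zpath Z1 s) (noise_vector xi1 s).
  apply: (noise_vector_independent X1 st).
  by have [] := measurable_wrt_pair (Zpath Z1 s) (Apath A1 s).
have ind2 : independent P2 (Zpath Z2 s) (noise_vector xi2 s).
  apply: (noise_vector_independent X2 st).
  by have [] := measurable_wrt_pair (Zpath Z2 s) (Apath A2 s).
rewrite nextE1 nextE2.
have := independent_law (mZ1 s) mY1 ind1 mM => ->.
have := independent_law (mZ2 s) mY2 ind2 mM => ->.
apply: product_measure_unique => // C D mC mD.
etransitivity; first exact: product_measure1E.
congr (_ * _)%E; apply/esym; first exact: (ih _ (ltnW st) mC).
exact: noiseE.
Qed.

Lemma joint_law_unique U :
  edge_paths_law B' B0' Z1 A1 t -> edge_paths_law B' B0' Z2 A2 t -> measurable U ->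
  P1 ((fun w => (Zpath Z1 t w, Apath A1 t w)) @^-1` U) =
  P2 ((fun w => (Zpath Z2 t w, Apath A2 t w)) @^-1` U).
Proof.
move=> law1 law2 mU.
have := joint_law_formula mB mB0 B01 B001 H1 law1 mU => ->.
have := joint_law_formula mB mB0 B01 B001 H2 law2 mU => ->.
have mZ1 := @measurable_Zpath _ _ _ _ _ _ Z1 t.
have mZ2 := @measurable_Zpath _ _ _ _ _ _ Z2 t.
apply: eq_bigr => x _.
apply: (@eq_measure_integral _ _ _ _ (distribution P2 (rv_of P2 mZ2))
  (distribution P1 (rv_of P1 mZ1))) => S mS _.
exact: Zpath_law_unique.
Qed.

End uniqueness.

(** The union of the three exceptional null sets is taken, so that a single [N] has to be
    avoided. *)
Lemma borel_kernel_version (R : realType) (d : nat)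
    (B : bool -> 'rV[R]_d -> 'rV[R]_d -> R) (B0 : 'rV[R]_d -> 'rV[R]_d -> R) :
  (forall a x y, 0 <= B a x y <= 1) -> (forall x y, 0 <= B0 x y <= 1) ->
  (forall a, ae_continuous2 (B a)) -> ae_continuous2 B0 ->
  exists (B' : bool -> 'rV[R]_d -> 'rV[R]_d -> R) (B0' : 'rV[R]_d -> 'rV[R]_d -> R)
      (N : set ('rV[R]_d * 'rV[R]_d)),
    [/\ (forall a, measurable_fun setT (fun z : 'rV[R]_d * 'rV[R]_d => B' a z.1 z.2)) /\
        measurable_fun setT (fun z : 'rV[R]_d * 'rV[R]_d => B0' z.1 z.2),
      (forall a x y, 0 <= B' a x y <= 1) /\ (forall x y, 0 <= B0' x y <= 1),
      measurable N /\ (lebesgue_rV R d \x lebesgue_rV R d)%E N = 0%E &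
      (forall a x y, ~ N (x, y) -> B a x y = B' a x y) /\
      (forall x y, ~ N (x, y) -> B0 x y = B0' x y)].
Proof.
move=> B01 B001 Bc B0c.
have [Bt [Nt [mt t01 mNt Nt0 tE]]] := ae_continuous2_borel (Bc true) (B01 true).
have [Bf [Nf [mf f01 mNf Nf0 fE]]] := ae_continuous2_borel (Bc false) (B01 false).
have [B' [N [m0 b01 mN N0 bE]]] := ae_continuous2_borel B0c B001.
exists (fun a => if a then Bt else Bf), B', (Nt `|` Nf `|` N); split; split => //.
- by case.
- by case.
- by apply: measurableU => //; exact: measurableU.
- by rewrite !measureU0//; exact: measurableU.
- move=> a x y nN; case: a; [apply: tE|apply: fE] => h; apply: nN; left; by [left|right].
- by move=> x y nN; apply: bE => h; apply: nN; right.
Qed.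

Theorem proposition2p6 (R : realType) (d : nat) (d_gt0 : (0 < d)%N)
    (gamma : R) (gamma01 : 0 < gamma < 1)
    (B : bool -> 'rV[R]_d -> 'rV[R]_d -> R) (B0 : 'rV[R]_d -> 'rV[R]_d -> R)
    (B_range : forall a x y, 0 <= B a x y <= 1)
    (B0_range : forall x y, 0 <= B0 x y <= 1)
    (B_continuous : forall a, ae_continuous2 (B a))
    (B0_continuous : ae_continuous2 B0)
    (B_sym : forall a x y, B a x y = B a y x)
    (B0_sym : forall x y, B0 x y = B0 y x)
    (mu0 noise : probability 'rV[R]_d R)
    (mu0_ac : mu0 `<< lebesgue_rV R d)
    (noise_ac : noise `<< lebesgue_rV R d)
    (k t : nat) (k_gt0 : (0 < k)%N) :
  let i1 : 'I_k := Ordinal k_gt0 in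
  let characterizes := characterizes_joint_law gamma B B0 mu0 noise t i1 in
  let law := is_joint_law gamma B B0 mu0 noise t i1 in
  let cond_a := @stepwise_cond_indep R d k t in
  let cond_b := @cond_indep_markov_chains R d B B0 k t in
  let cond_c := @pathwise_cond_indep R d k t in
  [/\ characterizes cond_a, characterizes cond_b & characterizes cond_c] /\
  (forall m, (law cond_a m <-> law cond_b m) /\ (law cond_b m <-> law cond_c m)).
Proof.
move=> i1 characterizes law cond_a cond_b cond_c.
have [B' [B0' [N [[mB mB0] [B01 B001] [mN N0] [BE B0E]]]]] :=
  borel_kernel_version B_range B0_range B_continuous B0_continuous.
have a_iff := stepwise_iff mB mB0 B01 B001 mN N0 BE B0E mu0_ac noise_ac.
have b_iff := chains_iff mB mB0 B01 B001 mN N0 BE B0E mu0_ac noise_ac.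
have c_iff := pathwise_iff mB mB0 B01 B001 mN N0 BE B0E mu0_ac noise_ac.
(* The probability space and the pair are kept: under the common requirements, each condition is
   equivalent to (L) for the same pair. *)
have ab m : law cond_a m <-> law cond_b m.
  by split => -[disp [T [P [Z [A [HC C mE]]]]]]; exists disp, T, P, Z, A;
    split => //; [apply/(b_iff _ _ _ _ _ _ _ _ _ HC)/(a_iff _ _ _ _ _ _ _ _ _ HC)|
                  apply/(a_iff _ _ _ _ _ _ _ _ _ HC)/(b_iff _ _ _ _ _ _ _ _ _ HC)].
have bc m : law cond_b m <-> law cond_c m.
  by split => -[disp [T [P [Z [A [HC C mE]]]]]]; exists disp, T, P, Z, A;
    split => //; [apply/(c_iff _ _ _ _ _ _ _ _ _ HC)/(b_iff _ _ _ _ _ _ _ _ _ HC)|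
                  apply/(b_iff _ _ _ _ _ _ _ _ _ HC)/(c_iff _ _ _ _ _ _ _ _ _ HC)].
have ca : characterizes cond_a.
  move=> m m' [d1 [T1 [P1 [Z1 [A1 [H1 C1 E1]]]]]].
  move=> [d2 [T2 [P2 [Z2 [A2 [H2 C2 E2]]]]]] U mU.
  rewrite -E1// -E2//.
  apply: (joint_law_unique mB mB0 B01 B001 mN N0 BE B0E mu0_ac noise_ac H1 H2) => //.
    by apply: (proj1 (a_iff _ _ _ _ _ _ _ _ _ H1)).
  by apply: (proj1 (a_iff _ _ _ _ _ _ _ _ _ H2)).
split; last by move=> m; split.
split => //.
- by move=> m m' /ab am /ab am'; exact: ca.
- by move=> m m' /bc /ab am /bc /ab am'; exact: ca.
Qed.
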